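(* Let $H>0$ and $S_H=\{z\in\mathbb{C}:\,|\operatorname{Im} z|\le H\}$. Let $\mu$ be a measure with support in $S_H$ which is either (a) positive and satisfies $\mu(\{z\in S_H:\,|\operatorname{Re} z|\le r\})\le C_0\max\{1,r^\rho\}$ for all $r>0$ with some positive constants $C_0,\rho$, or (b) a complex measure that is translation bounded on $S_H$, i.e. $\sup_{s\in\mathbb{R}}|\mu|(\{z\in S_H:\,s\le\operatorname{Re} z\le s+1\})<\infty$. Suppose that the c-Fourier transform of $\mu$ is a pure point measure $\hat\mu^c=\sum_{\gamma\in\Gamma}b_\gamma\delta_\gamma$, and that there exists $\eta>0$ such that for every $t\in\mathbb{R}$ the set $\Gamma\cap(t-\eta,t+\eta)$ is linearly independent over $\mathbb{Z}$. Then $$|\hat\mu^c|(t-1,t+1)=O(e^{2\pi H|t|})\quad\text{as } t\to\infty,$$ and $\hat\mu^c$ has type at most $2\pi H$ with respect to exponential growth, i.e. $\limsup_{r\to\infty}r^{-1}\log|\hat\mu^c|(-r,r)\le 2\pi H$.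
   Context: $|\sigma|$ denotes the variation of a complex measure $\sigma$. For $\varphi\in L^1(\mathbb{R})$ with compact support, $\hat\varphi^c(z)=\int_{\mathbb{R}}\varphi(t)e^{-2\pi i z t}\,dt$, $z\in\mathbb{C}$. Let $\mathcal{D}$ be the space of $C^\infty$ compactly supported functions on $\mathbb{R}$. For a measure $\mu$ on $S_H$ with $|\mu|(\{z\in S_H:|\operatorname{Re} z|\le r\})\le C\max\{1,r^\rho\}$ (which holds for translation bounded measures with $\rho=1$), the c-Fourier transform $\hat\mu^c$ is the functional on $\mathcal{D}$ given by $(\hat\mu^c,\varphi)=\int_{S_H}\hat\varphi^c(z)\,\mu(dz)$. ''$\hat\mu^c$ is a pure point measure $\sum_{\gamma\in\Gamma}b_\gamma\delta_\gamma$'' means $\Gamma\subset\mathbb{R}$ is countable, $b_\gamma\in\mathbb{C}$, $\sum_{\gamma\in\Gamma\cap K}|b_\gamma|<\infty$ for every compact $K$, and $(\hat\mu^c,\varphi)=\sum_\gamma b_\gamma\varphi(\gamma)$ for all $\varphi\in\mathcal{D}$; $\delta_\gamma$ is the unit mass at $\gamma$. A set $X\subset\mathbb{R}$ is linearly independent over $\mathbb{Z}$ if for any distinct $t_1,\dots,t_n\in X$ and $m_1,\dots,m_n\in\mathbb{Z}$, $m_1t_1+\dots+m_nt_n=0$ implies $m_1=\dots=m_n=0$. *)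

(* Defs.v *)
From mathcomp Require Import all_boot all_order all_algebra.
Import Order.TTheory GRing.Theory Num.Theory.
From mathcomp Require Import all_classical all_reals all_analysis.
From mathcomp Require Import complex.
Import numFieldNormedType.Exports.

Set Implicit Arguments.
Unset Strict Implicit.
Unset Printing Implicit Defensive.

Local Open Scope classical_set_scope.
Local Open Scope ring_scope.
Local Open Scope complex_scope.

Section Defs.
Context {R : realType}.

Definition cabs (z : R[i]) : R := Re `|z|.

Definition cexp (w : R[i]) : R[i] :=
  (expR (Re w) * cos (Im w)) +i* (expR (Re w) * sin (Im w)).

Definition smooth (f : R -> R) : Prop :=
  forall (n : nat) (x : R), derivable (derive1n n f) x 1.

Definition test_fun (phi : R -> R[i]) : Prop :=
  smooth (fun t => Re (phi t)) /\ smooth (fun t => Im (phi t)) /\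
  exists M : R, forall t, M < `|t| -> phi t = 0.

Definition cintegral d (T : measurableType d) (mu : {measure set T -> \bar R})
  (D : set T) (f : T -> R[i]) : R[i] :=
  (Rintegral mu D (fun x => Re (f x))) +i* (Rintegral mu D (fun x => Im (f x))).

Definition cFT (phi : R -> R[i]) (z : R[i]) : R[i] :=
  cintegral (@lebesgue_measure R) setT
    (fun t => phi t * cexp ((- (2 * pi * t))%:C * 'i * z)).

Definition cpt (p : R * R) : R[i] := p.1 +i* p.2.

Definition strip (H : R) : set (R * R) := [set p | `|p.2| <= H].

Definition rsum (A : set R) (g : R -> R) : R :=
  fine (\esum_(x in A) (Num.max (g x) 0)%:E) -
  fine (\esum_(x in A) (Num.max (- g x) 0)%:E).

Definition csum (A : set R) (g : R -> R[i]) : R[i] :=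
  rsum A (fun x => Re (g x)) +i* rsum A (fun x => Im (g x)).

(** variation of the pure point measure sum_{g in Gamma} b_g delta_g on a set A *)
Definition pp_var (Gamma : set R) (b : R -> R[i]) (A : set R) : \bar R :=
  \esum_(g in Gamma `&` A) (cabs (b g))%:E.

Definition Zlin_indep (X : set R) : Prop :=
  forall (s : seq R) (m : R -> int), uniq s -> (forall x, x \in s -> X x) ->
    \sum_(x <- s) (m x)%:~R * x = 0 -> forall x, x \in s -> m x = 0.

End Defs.

(* Main.v *)
(** Testing the identity [cFT mu = sum b_g delta_g] against [phi0 (t - u) exp (2 pi i s t)] shows that the
trigonometric sum [sum b_g phi0 (g - u) exp (2 pi i s g)] is bounded, uniformly in [s], by
[exp (2 pi H |u|)] times an integral of the rapidly decreasing [|cFT phi0 (z - s)|] against [|mu|], which is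
finite and independent of [s] when [mu] is translation bounded. Near [u] the frequencies are independent over
Z, so a Riesz product turns this uniform bound into a bound for the sum of the absolute values.

A positive [mu] of polynomial growth is translation bounded. Let [f] be smooth with compact support, its
transform [F] having real part at least [c > 0] near 0 and at least [- eps (1 + |x|)^-D] on a thin strip. A
dilation fits S_H into that strip, and the identity tested against the dilated [f exp (2 pi i s t)] gives
[c V(s) <= A + eps sum_k (1 + k)^-D (V(s + k L) + V(s - k L))] for the mass [V(s)] of the piece
[|Re z - s| <= L] of the strip. For small [eps] this is a contraction on functions of polynomial growth, so
iterating it removes the growth. *)

Require Import Defs.
From mathcomp Require Import all_boot all_order all_algebra.
Import Order.TTheory GRing.Theory Num.Theory.
From mathcomp Require Import all_classical all_reals all_analysis.
From mathcomp Require Import measurable_realfun complex ring lra.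
Import numFieldNormedType.Exports.

Set Implicit Arguments.
Unset Strict Implicit.
Unset Printing Implicit Defensive.

Local Open Scope classical_set_scope.
Local Open Scope ring_scope.
Local Open Scope complex_scope.

(** * Riesz products *)

(** Off the real axis the transform of a positive definite function need not be nonnegative, so a
    positive [mu] cannot be compared directly with the mass of a piece of S_H. The order of the
    choices overcomes this: the lower bound [c] near 0 is fixed first; the negative part is then
    made a small fraction of [c], by refining a Riemann sum and by thinning the strip; and the
    dilation that fits S_H into the thin strip only changes the length [L] on which mass is counted.
    The polynomial growth of [mu] is used to start the iteration: it makes all the integrals finite,
    and decay of order two above the growth makes the sums over [k] converge. The factor exp(2 pi H
    |u|) has a single source: translating a test function by [u] multiplies its transform at x + iy
    by exp(2 pi y u). Modulation by [s] only shifts x, and a translation bounded measure does not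
    notice such a shift. The Riesz product is averaged over the multiples of a small step instead of
    over an interval: the averages are then geometric sums, and no integral in [s] is taken. *)

Section Mean.
Context {C : numFieldType}.

(* Cesaro mean along the integers, with the error bounded by a constant before division by [J]. *)
Definition has_mean (f : nat -> C) (m : C) : Prop :=
  exists K : C, forall J : nat, `|\sum_(j < J) f j - J%:R * m| <= K.

Lemma has_mean_sum (I : finType) (c : I -> C) (f : I -> nat -> C) (m : I -> C) :
  (forall i, has_mean (f i) (m i)) ->
  has_mean (fun j => \sum_i c i * f i j) (\sum_i c i * m i).
Proof.
move=> /choice[K fK]; exists (\sum_i `|c i| * K i) => J.
rewrite exchange_big mulr_sumr -sumrB (le_trans (ler_norm_sum _ _ _))//.
apply: ler_sum => i _.
rewrite -mulr_sumr mulrCA -mulrBr normrM.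
by rewrite ler_wpM2l.
Qed.

Lemma has_meanB (f g : nat -> C) (m1 m2 : C) : has_mean f m1 -> has_mean g m2 ->
  has_mean (fun j => f j - g j) (m1 - m2).
Proof.
move=> [K fK] [L gL]; exists (K + L) => J.
rewrite sumrB; set F := \sum_(j < J) f j; set G := \sum_(j < J) g j.
have -> : F - G - J%:R * (m1 - m2) = (F - J%:R * m1) - (G - J%:R * m2) by ring.
by rewrite (le_trans (ler_normB _ _))// (lerD (fK J) (gL J)).
Qed.

(** For [z != 1] the partial sums (z^J - 1)/(z - 1) stay below 2/|z - 1|. This plays the part of the
    orthogonality of characters: the mean detects the resonance [z = 1]. *)
Lemma has_mean_geom (z : C) : `|z| = 1 -> has_mean (GRing.exp z) (z == 1)%:R.
Proof.
move=> z1; have [->|zN1] := eqVneq z 1.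
  exists 0 => J; under eq_bigr do rewrite expr1n.
  by rewrite sumr_const card_ord mulr1 subrr normr0.
exists (2 / `|z - 1|) => J; rewrite mulr0 subr0.
have z10 : 0 < `|z - 1| by rewrite normr_gt0 subr_eq0.
rewrite ler_pdivlMr// mulrC -normrM -subrX1 (le_trans (ler_normB _ _))//.
by rewrite normrX z1 expr1n normr1.
Qed.

End Mean.

Section Riesz.
Context {R : realType}.

Definition cis (x : R) : R[i] := cos x +i* sin x.

Lemma cis0 : cis 0 = 1. Proof. by rewrite /cis cos0 sin0. Qed.

Lemma cisD x y : cis (x + y) = cis x * cis y.
Proof. by rewrite /cis cosD sinD; congr (_ +i* _); rewrite addrC [X in _ + X]mulrC. Qed.

Lemma norm_cis x : `|cis x| = 1.
Proof. by rewrite normc_def /= cos2Dsin2 sqrtr1. Qed.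

Lemma conj_cis x : (cis x)^* = cis (- x).
Proof. by rewrite /cis /= cosN sinN. Qed.

Lemma cis_sum (I : Type) (s : seq I) (f : I -> R) :
  cis (\sum_(i <- s) f i) = \prod_(i <- s) cis (f i).
Proof. by elim/big_rec2: _ => [|i y x _ <-]; rewrite ?cis0 ?cisD. Qed.

Lemma cisMn x n : cis (n%:R * x) = cis x ^+ n.
Proof.
elim: n => [|n IH]; first by rewrite mul0r cis0.
by rewrite exprS -IH -cisD -[in LHS]natr1 mulrDl mul1r addrC.
Qed.

Lemma cis_eq1 x : `|x| < pi -> cis x = 1 -> x = 0.
Proof.
move=> xpi [cx1 _]; apply/eqP; rewrite -normr_eq0; apply/eqP; apply: cos_inj.
- by rewrite in_itv/= normr_ge0 ltW.
- by rewrite in_itv/= lexx pi_ge0.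
- by rewrite cos0 -cx1; case: (ler0P x) => // _; rewrite cosN.
Qed.

(** A mean with negative real part would make [- (J%:R * Re m)] exceed the error constant for large
    [J], while the partial sums have nonnegative real part. *)
Lemma has_mean_Re_ge0 (g : nat -> R[i]) m :
  has_mean g m -> (forall j, 0 <= Re (g j)) -> 0 <= Re m.
Proof.
move=> [K gK] g0; rewrite leNgt; apply/negP => m0.
have [K0 HK] : exists K0 : R, forall J : nat, - (J%:R * Re m) <= K0.
  exists (Re K) => J; have := gK J; rewrite lecE => /andP[_].
  apply: le_trans; have := normc_ge_Re (\sum_(j < J) g j - J%:R * m).
  rewrite lecE /= => /andP[_]; apply: le_trans.
  apply: le_trans (ler_norm _).
  rewrite raddfB /= raddf_sum /=.
  have -> : Re (J%:R * m) = J%:R * Re m.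
    by rewrite mulr_natl raddfMn mulr_natl.
  by rewrite -subr_ge0 opprK subrK; apply: sumr_ge0.
have := HK (Num.bound (K0 / - Re m)); rewrite leNgt => /negP; apply.
rewrite -mulrN -ltr_pdivrMr ?oppr_gt0//.
have [K00|K00] := leP 0 (K0 / - Re m); first exact: archi_boundP.
by rewrite (lt_le_trans K00).
Qed.


(* The Riesz product [\prod_k (1 + Re v_k)] is nonnegative with mean 1, and independence makes the mean of its
   product with [v_l] equal to 1/2, the only resonance being with the term [conj v_l / 2]. *)
Lemma riesz_unit n (lam : 'I_n -> R) (r : 'I_n -> R) (w : 'I_n -> R[i]) (A : R) :
  (forall m : 'I_n -> int, \sum_k (m k)%:~R * lam k = 0 -> forall k, m k = 0) ->
  (forall k, `|w k| = 1) ->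
  (forall s, \sum_k r k * Re (w k * cis (s * lam k)) <= A) ->
  \sum_k r k <= 2 * A.
Proof.
move=> indep w1 leA.
pose S := \sum_k `|lam k|.
have S0 : 0 <= S by apply: sumr_ge0.
(* All frequencies met below have absolute value at most [2 * S]; after scaling by [tau] they are
   less than [pi] in absolute value, so [cis] takes the value 1 only at frequency 0. *)
pose tau := (1 + 2 * S)^-1.
have tau0 : 0 < tau by rewrite invr_gt0; lra.
(* Expansion of 1 + Re v as conj v / 2 + 1 + v / 2: the index [e] stands for the exponent [e - 1] of
   [v], and a choice [f] of one term in each factor produces the frequency [Lam f]. *)
pose c k (e : 'I_3) : R[i] :=
  if e == 0 :> nat then (w k)^* / 2 else if e == 1 :> nat then 1 else w k / 2.
pose m (e : 'I_3) : int := e%:Z - 1.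
pose Lam (f : {ffun 'I_n -> 'I_3}) := \sum_k (m (f k))%:~R * lam k.
pose cf (f : {ffun 'I_n -> 'I_3}) := \prod_k c k (f k).
pose v k (j : nat) := w k * cis (j%:R * (tau * lam k)).
pose P j := \prod_k (1 + Re (v k j)).
have HP j : (P j)%:C = \sum_f cf f * cis (tau * Lam f) ^+ j.
  rewrite /P rmorph_prod /=.
  transitivity (\prod_(k < n) \sum_(e < 3) c k e * cis (j%:R * (tau * ((m e)%:~R * lam k)))).
    apply: eq_bigr => k _; rewrite !big_ord_recl big_ord0 addr0 /c /m /= ?rmorphD /=.
    rewrite ReJ_add /v.
    have -> z x : (z * cis x)^* = z^* * cis (- x) by rewrite -conj_cis; exact: rmorphM.
    have -> : (0%Z%:~R + (-1)%:~R) * lam k = - lam k by rewrite mulr0z add0r mulrN1z mulN1r.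
    have -> : ((bump 0 0)%:~R + (-1)%:~R) * lam k = 0.
      by rewrite mulrN1z (_ : bump 0 0 = 1%N)// subrr mul0r.
    have -> : ((bump 0 (bump 0 0))%:~R + (-1)%:~R) * lam k = lam k.
      by rewrite mulrN1z (_ : bump 0 _ = 2%N)//; ring.
    rewrite !mulrN !mulr0 cis0 rmorph1 mulr1.
    by field.
  etransitivity; first exact: (bigA_distr_bigA (fun (k : 'I_n) (e : 'I_3) =>
    c k e * cis (j%:R * (tau * ((m e)%:~R * lam k))))).
  apply: eq_bigr => f _.
  by rewrite big_split /= -cis_sum -cisMn /Lam -!mulr_sumr.
have tauLam f l : `|Lam f + l| <= 2 * S -> (cis (tau * (Lam f + l)) == 1) = (Lam f + l == 0).
  move=> le2S; apply/eqP/eqP => [|->]; last by rewrite mulr0 cis0.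
  move=> /cis_eq1 H.
  suff /H/eqP : `|tau * (Lam f + l)| < pi by rewrite mulf_eq0 gt_eqF//= => /eqP.
  rewrite normrM gtr0_norm// mulrC ltr_pdivrMr; last lra.
  rewrite (le_lt_trans le2S)//.
  by have := pi_ge2 R; nra.
have leLam f : `|Lam f| <= S.
  apply: le_trans (ler_norm_sum _ _ _) _; apply: ler_sum => k _.
  rewrite normrM ler_piMl// /m.
  by case: (f k) => -[|[|[|]]]//= _; rewrite ?normrN ?subrr ?normr0 ?normr1 ?ler01.
have meanP : has_mean (fun j => (P j)%:C) 1.
  rewrite (funext HP) (_ : 1 = \sum_f cf f * (cis (tau * Lam f) == 1)%:R).
    by apply: has_mean_sum => f; apply: has_mean_geom; rewrite norm_cis.
  rewrite (bigD1 [ffun=> inord 1])//= big1 ?addr0.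
    rewrite (_ : Lam _ = 0) ?mulr0 ?cis0 ?eqxx ?mulr1.
      by rewrite /cf big1// => k _; rewrite /c ffunE inordK.
    by rewrite /Lam big1// => k _; rewrite ffunE /m inordK// subrr mul0r.
  move=> f fN1; rewrite -[Lam f]addr0 tauLam ?addr0; last first.
    by rewrite (le_trans (leLam _))//; lra.
  case: eqP => [/indep mf0|]; rewrite ?mulr0//.
  case/eqP: fN1; apply/ffunP => k; rewrite ffunE; apply/val_inj => /=.
  rewrite inordK//; have /eqP := mf0 k; rewrite subr_eq0 => /eqP [].
  by [].
have meanPv l : has_mean (fun j => (P j)%:C * v l j) (2^-1).
  have HPv j : (P j)%:C * v l j = \sum_f (cf f * w l) * cis (tau * (Lam f + lam l)) ^+ j.
    rewrite HP mulr_suml; apply: eq_bigr => f _.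
    by rewrite /v !cisMn mulrDr cisD exprMn mulrACA.
  have LamE f : Lam f + lam l = \sum_k (m (f k) + (k == l))%:~R * lam k.
    rewrite (eq_bigr (fun k => (m (f k))%:~R * lam k + (k == l)%:R * lam k)).
      rewrite big_split /=; congr (_ + _); rewrite (bigD1 l)//= eqxx mul1r big1 ?addr0//.
      by move=> k /negPf ->; rewrite mul0r.
    by move=> k _; rewrite -mulrDl intrD.
  rewrite (funext HPv) (_ : 2^-1 = \sum_f (cf f * w l) * (cis (tau * (Lam f + lam l)) == 1)%:R).
    by apply: has_mean_sum => f; apply: has_mean_geom; rewrite norm_cis.
  rewrite (bigD1 [ffun k => if k == l then inord 0 else inord 1])//= big1 ?addr0.
    rewrite (_ : Lam _ + _ = 0) ?mulr0 ?cis0 ?eqxx ?mulr1.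
      rewrite /cf (bigD1 l)//= big1.
        rewrite ffunE eqxx /c inordK//= mulr1 mulrAC.
        by rewrite [_ * w l]mulrC -sqr_normc w1 expr1n mul1r.
      by move=> k /negPf kl; rewrite /c ffunE kl inordK.
    rewrite LamE big1// => k _; rewrite ffunE /m.
    by case: eqP => _; rewrite inordK// ?subrr ?sub0r ?addNr ?addr0 mul0r.
  move=> f fN1; rewrite tauLam; last first.
    rewrite (le_trans (ler_normD _ _))// mulr_natl mulr2n lerD//.
    by rewrite /S (bigD1 l)//= lerDl sumr_ge0.
  case: eqP => [|]; rewrite ?mulr0// LamE => /indep mf0.
  case/eqP: fN1; apply/ffunP => k; rewrite ffunE; apply/val_inj => /=.
  have := mf0 k; rewrite /m; case: eqP => _; rewrite inordK//.
    by rewrite subrK => -[].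
  by rewrite addr0 => /eqP; rewrite subr_eq0 => /eqP [].
(* The mean of [P j * (A - \sum_k r k * Re (v k j))], a product of two nonnegative factors, is [A]
   minus half the sum of the [r k]. The one-point index type ['I_1] turns [has_mean_sum] into
   multiplication by the scalar [A]. *)
have := has_meanB (has_mean_sum (fun=> A%:C) (fun _ : 'I_1 => meanP))
  (has_mean_sum (fun l => (r l)%:C) meanPv).
move=> /has_mean_Re_ge0; rewrite !big_ord1 mulr1 raddfB raddf_sum /= => H.
suff : 0 <= A - 2^-1 * \sum_k r k by lra.
apply: le_trans (H _) _.
  move=> j; rewrite big_ord1 raddfB raddf_sum /=.
  have -> : A * P j - 0 * 0 - \sum_(l < n) Re ((r l)%:C * ((P j)%:C * v l j)) =
    P j * (A - \sum_k r k * Re (v k j)).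
    rewrite mul0r subr0 mulrBr mulrC mulr_sumr; congr (_ - _); apply: eq_bigr => k _.
    by case: (v k j) => a b /=; ring.
  apply: mulr_ge0.
    apply: prodr_ge0 => k _.
    have : `|v k j| = 1 by rewrite /v normrM w1 norm_cis mulr1.
    have := normc_ge_Re (v k j) => /[swap] ->.
    by rewrite lecR ler_norml => /andP[]; lra.
  rewrite subr_ge0 (le_trans _ (leA (j%:R * tau)))//.
  by apply: ler_sum => k _; rewrite /v mulrA.
rewrite lerD2l lerN2 mulr_sumr; apply: ler_sum => k _ /=.
have -> : (1 + 1) / ((1 + 1) ^+ 2 + (0 + 0) ^+ 2) = 2^-1 :> R by field.
by rewrite mul0r subr0 mulrC.
Qed.

Lemma cabsE (z : R[i]) : (cabs z)%:C = `|z|.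
Proof. by rewrite /cabs RRe_real ?normr_real. Qed.

(** Polar form of the coefficients: the moduli become the weights [r] and the phases the unimodular
    [w], a vanishing coefficient receiving the phase 1. *)
Lemma riesz_bound (s : seq R) (a : R -> R[i]) (X : set R) (A : R) :
  Zlin_indep X -> uniq s -> (forall x, x \in s -> X x) ->
  (forall t, Re (\sum_(x <- s) a x * cis (t * x)) <= A) ->
  \sum_(x <- s) cabs (a x) <= 2 * A.
Proof.
move=> indX us sX leA.
rewrite (big_nth 0) big_mkord.
pose w (k : 'I_(size s)) := if a s`_k == 0 then 1 else a s`_k / `|a s`_k|.
apply: (@riesz_unit _ (fun k => s`_k) (fun k => cabs (a s`_k)) w) => [m m0 k|k|t].
(* [Zlin_indep] wants integer coefficients indexed by reals; those indexed by positions are carried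
   over through [index], which inverts [nth] because [s] has no repetition. *)
- have := indX s (fun x => if insub (index x s) is Some k then m k else 0) us sX.
  rewrite (big_nth 0) big_mkord (eq_bigr (fun k : 'I__ => (m k)%:~R * s`_k)).
    by move=> /(_ m0 s`_k (mem_nth _ (ltn_ord k))); rewrite index_uniq// valK.
  by move=> i _; rewrite index_uniq// valK.
- rewrite /w; case: ifPn => [_|ak0]; first by rewrite normr1.
  by rewrite normrM normfV normr_id divff// normr_eq0.
- apply: le_trans (leA t).
  rewrite (big_nth 0) big_mkord raddf_sum /=; apply: ler_sum => k _.
  have aE : a s`_k = (cabs (a s`_k))%:C * w k.
    rewrite cabsE /w; case: eqP => [->|/eqP ak0]; first by rewrite normr0 mul0r.
    by rewrite mulrC divfK// normr_eq0.
  rewrite [X in _ <= Re (X * _)]aE -mulrA; case: (w k * _) => x y /=.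
  by rewrite mul0r subr0.
Qed.
End Riesz.

(** * Smooth functions and a bump function *)

Section Smooth.
Context {R : realType}.
Implicit Types f g : R -> R.

Lemma derive1_eq f g : (forall x : R, is_derive x (1 : R) f (g x)) -> (derive1 f) = g.
Proof. by move=> fg; apply/funext => x; rewrite derive1E; case: (fg x). Qed.

(** Coinduction principle: a class of functions closed under differentiation consists of smooth
    functions. It replaces explicit formulas for higher derivatives by the choice of a suitable
    class. *)
Lemma smooth_coind (P : (R -> R) -> Prop) :
  (forall f, P f -> exists2 g, P g & forall x : R, is_derive x (1 : R) f (g x)) ->
  forall f, P f -> smooth f.
Proof.
move=> HP f Pf n; have : P ((derive1n n f)).
  elim: n => // n /HP[g Pg fg]; rewrite derive1nS.
  by rewrite (derive1_eq fg).
by move=> /HP[g _ fg] x; case: (fg x).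
Qed.

Lemma smooth_is_derive f (x : R) : smooth f -> is_derive x (1 : R) f ((derive1 f) x).
Proof. by move=> sf; rewrite derive1E; apply/derivableP; exact: (sf 0%N). Qed.

Lemma smooth_derive1 f : smooth f -> smooth (derive1 f).
Proof. by move=> sf n x; rewrite -derive1Sn; exact (sf n.+1 x). Qed.

Lemma smooth_derive1n f n : smooth f -> smooth (derive1n n f).
Proof. elim: n => [|n IH] sf; first exact sf.
by rewrite derive1nS; exact (smooth_derive1 (IH sf)). Qed.

Lemma smooth_continuous f : smooth f -> continuous f.
Proof.
by move=> sf x; apply/differentiable_continuous/derivable1_diffP; exact: (sf 0%N).
Qed.

Lemma smoothM f g : smooth f -> smooth g -> smooth (fun x => f x * g x).
Proof.
move=> sf sg.
(* Finite sums of products of smooth functions are closed under differentiation by the Leibniz rule,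
   whereas single products are not. *)
apply: (smooth_coind (P := fun h => exists2 s : seq ((R -> R) * (R -> R)),
    (forall p, List.In p s -> smooth p.1 /\ smooth p.2) &
    h = (fun x => \sum_(p <- s) p.1 x * p.2 x))); last first.
  exists [:: (f, g)]; first by move=> p [<-|[]]; exact (conj sf sg).
  by apply/funext => x; rewrite big_seq1.
move=> _ [s ss ->].
exists (fun x => \sum_(p <- s) ((derive1 p.1) x * p.2 x + p.1 x * (derive1 p.2) x)).
  exists (flatten [seq [:: ((derive1 p.1), p.2); (p.1, (derive1 p.2))] | p <- s]).
    elim: s ss => [_ p []|q s IH ss p /= [<-|[<-|]]] /=.
    - by case: (ss q (or_introl erefl)) => q1 q2; exact (conj (smooth_derive1 q1) q2).
    - by case: (ss q (or_introl erefl)) => q1 q2; exact (conj q1 (smooth_derive1 q2)).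
    - by apply: IH => r rs; apply: ss; right.
  apply/funext => x; rewrite big_flatten big_map; apply: eq_bigr => p _.
  by rewrite unlock /= addr0.
move=> x; elim: s ss => [_|q s IH ss].
  rewrite big_nil (_ : (fun _ => _) = cst 0); first exact: is_derive_cst.
  by apply/funext => y; rewrite big_nil.
rewrite big_cons (_ : (fun _ => _) =
    (q.1 * q.2) + (fun y => \sum_(p <- s) p.1 y * p.2 y)); last first.
  by apply/funext => y; rewrite big_cons.
apply: is_deriveD; last by apply: IH => p ps; apply: ss; right.
have [/(smooth_is_derive x) d1 /(smooth_is_derive x) d2] := ss q (or_introl erefl).
have := is_deriveM d1 d2; rewrite /GRing.scale/= addrC.
by rewrite [q.2 x * _]mulrC.
Qed.

Lemma smooth_cst (c : R) : smooth (fun=> c).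
Proof.
apply: (smooth_coind (P := fun h => exists c : R, h = cst c)); last by exists c.
by move=> _ [d ->]; exists (cst 0); [exists 0|move=> x; exact: is_derive_cst].
Qed.

Lemma smooth_affine f (c d : R) : smooth f -> smooth (fun x => f (c * x + d)).
Proof.
move=> sf.
apply: (smooth_coind (P := fun h => exists e n, h = (fun x => e * (derive1n n f) (c * x + d)))).
  move=> _ [e [n ->]]; exists (fun x => (e * c) * (derive1n n.+1 f) (c * x + d)).
    by exists (e * c), n.+1.
  move=> x; rewrite derive1nS.
  have := smooth_is_derive (c * x + d) (smooth_derive1n (n := n) sf) => D.
  have E : is_derive x (1 : R) (fun x => c * x + d) c.
    have := is_deriveD (is_deriveZ c (is_derive_id x (1 : R))) (is_derive_cst d x (1 : R)).
    by rewrite /GRing.scale/= mulr1 addr0.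
  have F := @is_derive1_comp R (derive1n n f) (fun x => c * x + d) x _ _ D E.
  have := is_deriveZ e F.
  rewrite (_ : e \*: _ = (fun x => e * (derive1n n f) (c * x + d)))//.
  by rewrite (_ : e *: _ = e * c * (derive1 (derive1n n f)) (c * x + d))// /GRing.scale/=; ring.
by exists 1, 0%N; apply/funext => x; rewrite mul1r.
Qed.

Lemma smoothD f g : smooth f -> smooth g -> smooth (fun x => f x + g x).
Proof.
move=> sf sg; apply: (smooth_coind (P := fun h => exists f g, [/\ smooth f, smooth g &
  h = (fun x => f x + g x)])); last by exists f, g.
move=> _ [h [k [sh sk ->]]]; exists (fun x => (derive1 h) x + (derive1 k) x).
  exists (derive1 h), (derive1 k); split; last by [].
    exact (smooth_derive1 sh).
  exact (smooth_derive1 sk).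
move=> x; exact (is_deriveD (smooth_is_derive x sh) (smooth_is_derive x sk)).
Qed.

Lemma smooth_sum (I : Type) (s : seq I) (F : I -> R -> R) :
  (forall i, smooth (F i)) -> smooth (fun x => \sum_(i <- s) F i x).
Proof.
move=> sF; elim: s => [|i s IH].
  rewrite (_ : (fun _ => _) = (fun=> 0)); first exact (@smooth_cst 0).
  by apply/funext => x; rewrite big_nil.
rewrite (_ : (fun _ => _) = (fun x => F i x + \sum_(i <- s) F i x)); first exact (smoothD (sF i) IH).
by apply/funext => x; rewrite big_cons.
Qed.

Lemma smooth_cos_sin (c d : R) : smooth (fun x => c * cos x + d * sin x).
Proof.
apply: (smooth_coind (P := fun h => exists c d, h = (fun x : R => c * cos x + d * sin x))); last first.
  by exists c, d.
move=> _ [a [b ->]]; exists (fun x => b * cos x + - a * sin x); first by exists b, (- a).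
move=> x; apply: is_derive_eq.
rewrite /GRing.scale/=; ring.
Qed.

Lemma smooth_cos : smooth (@cos R).
Proof.
rewrite (_ : @cos R = (fun x => 1 * cos x + 0 * sin x)); first exact (@smooth_cos_sin _ _).
by apply/funext => x; rewrite mul1r mul0r addr0.
Qed.

Lemma smooth_sin : smooth (@sin R).
Proof.
rewrite (_ : @sin R = (fun x => 0 * cos x + 1 * sin x)); first exact (@smooth_cos_sin _ _).
by apply/funext => x; rewrite mul1r mul0r add0r.
Qed.

(** The difference quotient at [x] is at most [C * |y - x|]. This handles the endpoints 0 and 1 of
    the support of [hump], where the differentiation rules do not apply to a function given by
    cases. *)
Lemma is_derive_square_bound f (x C : R) :
  (forall y, `|f y| <= C * (y - x) ^+ 2) -> is_derive x (1 : R) f 0.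
Proof.
move=> fC; apply/is_derive1_caratheodory.
have fx0 : f x = 0.
  by apply/eqP; rewrite -normr_le0; have := fC x; rewrite subrr expr0n mulr0.
exists (fun z => f z / (z - x)); split.
- move=> z; rewrite fx0 subr0; have [->|zx] := eqVneq z x.
    by rewrite fx0 mul0r mul0r.
  by rewrite divfK// subr_eq0.
- rewrite /prop_for /continuous_at /= fx0 mul0r.
  apply/cvgrPdist_le => e e0; rewrite near_simpl.
  near=> z; rewrite sub0r normrN normrM normfV.
  have [->|zx] := eqVneq z x; first by rewrite fx0 normr0 mul0r ltW.
  have zx0 : 0 < `|z - x| by rewrite normr_gt0 subr_eq0.
  rewrite ler_pdivrMr// (le_trans (fC z))// -real_normK ?num_real// expr2 mulrA.
  rewrite ler_wpM2r//.
  have C0 : 0 <= `|C| by [].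
  apply: (@le_trans _ _ ((`|C| + 1) * `|z - x|)).
    by rewrite ler_wpM2r// (le_trans (ler_norm _))// lerDl.
  rewrite -ler_pdivlMl; last by lra.
  rewrite distrC; rewrite ltW//; near: z; apply: nbhsx_ballx.
  by rewrite mulr_gt0// invr_gt0; lra.
- by rewrite fx0 mul0r.
Unshelve. all: by end_near. Qed.

End Smooth.

Section Hump.
Context {R : realType}.

Definition hump (x : R) : R :=
  if 0 < x < 1 then expR (- (x * (1 - x))^-1) else 0.

Lemma hump_ge0 x : 0 <= hump x.
Proof. by rewrite /hump; case: ifP => // _; exact: expR_ge0. Qed.

Lemma hump_gt0 x : 0 < x < 1 -> 0 < hump x.
Proof. by rewrite /hump => ->; exact: expR_gt0. Qed.

Lemma hump_out x : ~~ (0 < x < 1) -> hump x = 0.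
Proof. by rewrite /hump => /negPf ->. Qed.

Lemma hump_le1 x : hump x <= 1.
Proof.
rewrite /hump; case: ifP => [/andP[x0 x1]|_]; last exact: ler01.
by rewrite expR_le1 oppr_le0 invr_ge0 mulr_ge0 ?subr_ge0 ?ltW.
Qed.

(** The shape of every derivative of [hump]: a polynomial times a power of 1/(x(1 - x)) times
    [hump]. This is the class used with [smooth_coind]. *)
Let psi (p : {poly R}) (k : nat) (x : R) : R :=
  p.[x] * (x * (1 - x))^-1 ^+ k * hump x.

Lemma horner_le (p : {poly R}) x : 0 <= x <= 1 -> `|p.[x]| <= \sum_(i < size p) `|p`_i|.
Proof.
move=> /andP[x0 x1]; rewrite horner_coef (le_trans (ler_norm_sum _ _ _))//.
apply: ler_sum => i _; rewrite normrM ler_piMr// normrX exprn_ile1//.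
by rewrite ger0_norm.
Qed.

Lemma expRN_le (w : R) n : 0 < w -> w ^+ n * expR (- w) <= n`!%:R.
Proof.
case: n => [|n] w0; first by rewrite expr0 mul1r fact0 expR_le1 oppr_le0 ltW.
rewrite expRN ler_pdivrMr ?expR_gt0// mulrC -ler_pdivrMr ?ltr0n ?fact_gt0//.
by rewrite (le_trans _ (expR_ge1Dxn n (ltW w0)))// lerDr.
Qed.

(** The exponential absorbs [k + 2] powers of 1/(x(1 - x)), of which [psi] contains only [k]; the
    two to spare give the square needed by [is_derive_square_bound]. *)
Lemma psi_bound p k : exists C, forall x, 0 < x < 1 -> `|psi p k x| <= C * (x * (1 - x)) ^+ 2.
Proof.
pose S := \sum_(i < size p) `|p`_i|.
exists (S * (k.+2)`!%:R) => x x01.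
rewrite /psi /hump x01; move/andP: (x01) => [x0 x1].
set y := x * (1 - x); have y0 : 0 < y by rewrite mulr_gt0// subr_gt0.
clearbody y; rewrite -!mulrA normrM ler_pM//; first by apply: horner_le; rewrite !ltW.
rewrite ger0_norm ?mulr_ge0 ?exprn_ge0 ?expR_ge0 ?invr_ge0 ?(ltW y0)//.
rewrite -ler_pdivrMr ?exprn_gt0//.
have := @expRN_le y^-1 k.+2; rewrite invr_gt0 2!exprSr => /(_ y0).
rewrite expr2 invfM; apply: le_trans; rewrite le_eqVlt; apply/orP; left; apply/eqP.
by move: (y^-1) (expR _) (y^-1 ^+ k) => a b c; ring.
Qed.

Lemma smooth_hump : smooth hump.
Proof.
apply: (smooth_coind (P := fun f => exists p k, f = psi p k)); last first.
  by exists 1, 0%N; apply/funext => x; rewrite /psi hornerC expr0 !mul1r.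
move=> _ [p [k ->]].
pose P : {poly R} := 'X * (1 - 'X).
(* With Y = x(1 - x), the derivative of p Y^-k exp(-1/Y) is (p' Y^2 - k p Y' Y + p Y') Y^-(k+2)
   exp(-1/Y), and Y' = 1 - 2x. *)
exists (psi (p^`() * P ^+ 2 - p * (1 - 2 *: 'X) * P *+ k + p * (1 - 2 *: 'X)) k.+2).
  by eexists; eexists.
move=> x; have [x01|x01] := boolP (0 < x < 1); last first.
  (* For [x] outside the open unit interval and [y] inside it, y(1 - y) is at most |y - x|, so the
     bound of [psi_bound] becomes quadratic in [y - x]. *)
  have [C HC] := psi_bound p k.
  rewrite {2}/psi hump_out// mulr0; apply: (@is_derive_square_bound _ _ _ `|C|) => y.
  have [y01|y01] := boolP (0 < y < 1); last first.
    by rewrite /psi (hump_out y01) mulr0 normr0 mulr_ge0// sqr_ge0.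
  apply: (le_trans (HC _ y01)); apply: (@le_trans _ _ (`|C| * (y * (1 - y)) ^+ 2)).
    by rewrite ler_wpM2r ?sqr_ge0 ?ler_norm.
  rewrite ler_wpM2l//.
  move/andP: y01 => [y0 y1].
  have xout : x <= 0 \/ 1 <= x.
    by move: x01; rewrite negb_and -!leNgt => /orP[]; [left|right].
  have q0 : 0 <= y * (1 - y) by nra.
  case: xout => xout; last rewrite -[y - x]opprB sqrrN.
    by rewrite ler_pXn2r ?nnegrE//; nra.
  by rewrite ler_pXn2r ?nnegrE//; nra.
have Y0 : x * (1 - x) != 0.
  by move/andP: x01 => [x0 x1]; rewrite mulf_neq0 ?gt_eqF ?subr_gt0.
have dY : is_derive x (1 : R) (fun z => z * (1 - z)) (1 - 2 * x).
  apply: (is_derive_eq (is_deriveM (is_derive_id x (1 : R))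
    (is_deriveB (is_derive_cst (1 : R) x (1 : R)) (is_derive_id x (1 : R))))).
  rewrite /GRing.scale /= !fctE; ring.
have dW := @is_deriveV R (fun z => z * (1 - z)) x _ _ Y0 dY.
have dWk := is_deriveX k dW.
have dE := is_derive1_comp (is_derive_expR _) (is_deriveN dW).
have dp := is_derive_poly p x.
have D := is_deriveM (is_deriveM dp dWk) dE.
apply: (near_eq_is_derive _ (is_derive_eq D _)).
  near=> z.
  have z01 : 0 < z < 1.
    have : z \in `]0, 1[ by near: z; apply: near_in_itvoo; rewrite in_itv.
    by rewrite in_itv.
  by rewrite !fctE /= /psi /hump z01.
rewrite /psi /hump x01 !fctE /GRing.scale /=.
rewrite /P expr2 !(hornerD, hornerN, hornerM, hornerMn, hornerZ, hornerX, hornerC) /=.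
move: Y0; set Y := x * (1 - x) => Y0.
move: (expR _) (p.[x]) (p^`().[x]) (1 - 2 * x) => e a b c.
rewrite !exprVn; case: k {dWk D} => [|k] /=.
  by field.
rewrite -mulr_natr !exprS; move: (Y ^+ k) (expf_neq0 k Y0) => u u0.
by field; rewrite Y0 u0.
Unshelve. all: by end_near.
Qed.

End Hump.

(** * Fourier-Laplace transforms of compactly supported functions *)

Section CompactIntegral.
Context {R : realType}.
Implicit Types f g F : R -> R.
Local Notation mu := (@lebesgue_measure R).

Definition cc f := continuous f /\ exists M, forall t, M < `|t| -> f t = 0.

Definition Ir f : R := \int[mu]_t f t.

Lemma cc_restrict f M : (forall t, M < `|t| -> f t = 0) -> f = f \_ `[- M, M].
Proof.
move=> fM; apply/funext => t; rewrite patchE; case: ifPn => //.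
by rewrite notin_setE /= in_itv /= -ler_norml => /negP; rewrite -ltNge => /fM.
Qed.

Lemma cc_integrable f : cc f -> mu.-integrable setT (EFin \o f).
Proof.
move=> [cf [M fM]]; rewrite (cc_restrict fM) -restrict_EFin.
have mM : measurable (`[- M, M] : set (measurableTypeR R)) by exact: measurable_itv.
apply: (integrable_mkcond _ mM).1.
apply: continuous_compact_integrable; first exact: segment_compact.
exact: continuous_subspaceT.
Qed.

Lemma Ir_segment f (M a b : R) : (forall t, M < `|t| -> f t = 0) -> a <= - M -> M <= b ->
  Ir f = \int[mu]_(t in `[a, b]) f t.
Proof.
move=> fM aM Mb; rewrite Rintegral_mkcond /Ir; congr Rintegral.
apply/funext => t; rewrite patchE; case: ifPn => //.
rewrite notin_setE /= in_itv /= => tab; apply: fM.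
rewrite ltNge ler_norml; apply/negP => /andP[h1 h2]; apply: tab.
by rewrite (le_trans aM)//= (le_trans h2).
Qed.

Lemma Ir_FTC f F (M a b : R) : continuous f -> (forall t, M < `|t| -> f t = 0) ->
  a <= - M -> M <= b -> a < b ->
  (forall x : R, is_derive x (1 : R) F (f x)) -> Ir f = F b - F a.
Proof.
move=> cf fM aM Mb ab dF; rewrite (Ir_segment fM aM Mb) /Rintegral.
have cF x : {for x, continuous F}.
  by apply/differentiable_continuous/derivable1_diffP; case: (dF x).
rewrite (@continuous_FTC2 _ f F a b)//.
- exact: continuous_subspaceT.
- split.
  + by move=> x _; case: (dF x).
  + by apply: cvg_at_right_filter; exact: cF.
  + by apply: cvg_at_left_filter; exact: cF.
- by move=> x _; rewrite derive1E; case: (dF x).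
Qed.

Lemma cc_antiderivative f : cc f -> exists F, forall x : R, is_derive x (1 : R) F (f x).
Proof.
move=> ccf; exists (fun x => \int[mu]_(t in [set` Interval -oo%O (BRight x)]) f t) => x.
have int : mu.-integrable [set` Interval -oo%O (BRight (x + 1))] (EFin \o f).
  exact: integrableS (cc_integrable ccf).
have x1 : x < x + 1 by rewrite ltrDl.
have [dF F'] := @continuous_FTC1 R f -oo%O x (x + 1) x1 int (ltNyr x) (ccf.1 x).
exact (DeriveDef dF (eq_trans (esym (derive1E _ _)) F')).
Qed.

Lemma cc_vanish2 f g : cc f -> cc g -> exists M, 0 < M /\
  forall t, M < `|t| -> f t = 0 /\ g t = 0.
Proof.
move=> [_ [M fM]] [_ [N gN]]; exists (1 + `|M| + `|N|); split.
  by rewrite -addrA ltr_wpDr// addr_ge0.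
move=> t tMN; split; [apply: fM|apply: gN]; apply: le_lt_trans tMN.
  by rewrite (le_trans (ler_norm M))// addrAC lerDr addr_ge0.
by rewrite (le_trans (ler_norm N))// lerDr addr_ge0.
Qed.

Lemma ccD f g : cc f -> cc g -> cc (fun t => f t + g t).
Proof.
move=> cf cg; split.
  by move=> x; apply: cvgD; [exact: cf.1|exact: cg.1].
have [M [_ H]] := cc_vanish2 cf cg.
by exists M => t /H[-> ->]; rewrite addr0.
Qed.

Lemma ccM f g : cc f -> continuous g -> cc (fun t => f t * g t).
Proof.
move=> [cf [M fM]] cg; split.
  by move=> x; apply: cvgM; [exact: cf|exact: cg].
by exists M => t /fM ->; rewrite mul0r.
Qed.

Lemma ccZ c f : cc f -> cc (fun t => c * f t).
Proof.
move=> ccf; rewrite (_ : (fun _ => _) = (fun t => f t * cst c t)).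
  by apply: ccM => // x; exact: cvg_cst.
by apply/funext => t; rewrite mulrC.
Qed.

Lemma cc_norm f : cc f -> cc (fun t => `|f t|).
Proof.
move=> [cf [M fM]]; split; last by exists M => t /fM ->; rewrite normr0.
by move=> x; apply: cvg_norm; exact: cf.
Qed.

Lemma IrD f g : cc f -> cc g -> Ir (fun t => f t + g t) = Ir f + Ir g.
Proof. by move=> cf cg; apply: RintegralD => //; exact: cc_integrable. Qed.

Lemma IrZ c f : cc f -> Ir (fun t => c * f t) = c * Ir f.
Proof. by move=> cf; apply: RintegralZl => //; exact: cc_integrable. Qed.

Lemma le_Ir f g : cc f -> cc g -> (forall t, f t <= g t) -> Ir f <= Ir g.
Proof.
by move=> cf cg fg; apply: le_Rintegral => //; exact: cc_integrable.
Qed.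

Lemma Ir_ge0 f : (forall t, 0 <= f t) -> 0 <= Ir f.
Proof. by move=> f0; apply: Rintegral_ge0. Qed.

Lemma le_norm_Ir f : cc f -> `|Ir f| <= Ir (fun t => `|f t|).
Proof. by move=> cf; apply: le_normr_Rintegral => //; exact: cc_integrable. Qed.

Lemma cc_affine f (c d : R) : 0 < c -> cc f -> cc (fun t => f (c * t + d)).
Proof.
move=> c0 [cf [M fM]]; split.
  move=> x; apply: (@continuous_comp _ _ _ (fun t : R => c * t + d) f); last exact: cf.
  apply: cvgD; last exact: cvg_cst.
  by apply: cvgM; [exact: cvg_cst|exact: cvg_id].
exists ((`|M| + `|d|) / c) => t; rewrite ltr_pdivrMr// => tM; apply: fM.
rewrite (le_lt_trans (ler_norm M))// -(ltrD2r `|d|).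
rewrite (lt_le_trans tM)// mulrC -{1}(gtr0_norm c0) -normrM.
by rewrite -{1}(addrK d (c * t)) (le_trans (ler_normB _ _)).
Qed.

(** Change of variables through an antiderivative [F] of [f]: [c^-1 * F (c * t + d)] is one for the
    dilated function, and both integrals are increments of [F]. *)
Lemma Ir_affine f (c d : R) : 0 < c -> cc f -> Ir (fun t => f (c * t + d)) = c^-1 * Ir f.
Proof.
move=> c0 ccf; have [F dF] := cc_antiderivative ccf.
have ccg := cc_affine d c0 ccf.
have [M [M0 HM]] := cc_vanish2 ccf ccg.
(* Large enough that the interval from [- N] to [N] and its image under t -> c t + d both contain
   the interval from [- M] to [M]. *)
pose N := M + (M + `|d|) / c.
have MN : M <= N by rewrite lerDl divr_ge0// ?addr_ge0// ltW.
have cNM : c * N - `|d| >= M.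
  by rewrite lerBrDr mulrDr mulrC (mulrC c) divfK ?gt_eqF// lerDr mulr_ge0 ?ltW.
have dG (x : R) : is_derive x (1 : R) (fun t => c^-1 * F (c * t + d)) (f (c * x + d)).
  have E : is_derive x (1 : R) (fun x => c * x + d) c.
    apply: (is_derive_eq (is_deriveD (is_deriveZ c (is_derive_id x (1 : R)))
      (is_derive_cst d x (1 : R)))).
    by rewrite /GRing.scale/= mulr1 addr0.
  have D := @is_derive1_comp R F (fun x => c * x + d) x _ _ (dF _) E.
  apply: (is_derive_eq (is_deriveZ c^-1 D)).
  by rewrite /GRing.scale/= mulrCA mulVf ?mulr1// gt_eqF.
have fM t : M < `|t| -> f t = 0 by move=> /HM[].
have gM t : M < `|t| -> f (c * t + d) = 0 by move=> /HM[].
have NM : - N <= - M by rewrite lerN2.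
have NN : - N < N by lra.
rewrite (@Ir_FTC _ _ M (- N) N ccg.1 gM NM MN NN dG).
have dle : d <= `|d| by exact: ler_norm.
have dge : - d <= `|d| by rewrite -normrN ler_norm.
have h1 : c * - N + d <= - M by lra.
have h2 : M <= c * N + d by lra.
have h3 : c * - N + d < c * N + d by lra.
rewrite (@Ir_FTC _ F M (c * - N + d) (c * N + d) ccf.1 fM h1 h2 h3 dF); ring.
Qed.

Lemma derive1_out f M : (forall t, M < `|t| -> f t = 0) -> forall t, M < `|t| -> derive1 f t = 0.
Proof.
move=> fM t Mt; rewrite derive1E (near_eq_derive (g := cst 0)) ?derive_cst//.
near=> s; apply: fM.
near: s; apply: (cvgr_gt `|t|) => //; exact: norm_continuous.
Unshelve. all: by end_near. Qed.

Lemma cc_derive1 f : smooth f -> cc f -> cc (derive1 f).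
Proof.
move=> sf [_ [M fM]]; split; last by exists M; exact: derive1_out.
exact (smooth_continuous (smooth_derive1 sf)).
Qed.

Lemma Ir_derive f g : cc f -> cc g -> (forall x : R, is_derive x (1 : R) f (g x)) -> Ir g = 0.
Proof.
move=> ccf ccg df.
have [M [M0 HM]] := cc_vanish2 ccf ccg.
have fM t : M + 1 <= `|t| -> f t = 0 by move=> Mt; apply: (HM _ _).1; lra.
have gM t : M + 1 < `|t| -> g t = 0 by move=> Mt; apply: (HM _ _).2; lra.
have NN : - (M + 1) < M + 1 by lra.
rewrite (@Ir_FTC _ f (M + 1) (- (M + 1)) (M + 1) ccg.1 gM (lexx _) (lexx _) NN df).
by rewrite !fM ?subrr// ?normrN gtr0_norm//; lra.
Qed.

End CompactIntegral.

Section Cabs.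
Context {R : realType}.
Implicit Types z w : R[i].

Lemma cabs_ge0 z : 0 <= cabs z.
Proof. by rewrite -ler0c cabsE. Qed.

Lemma cabsM z w : cabs (z * w) = cabs z * cabs w.
Proof. by apply: complexI; rewrite rmorphM /= !cabsE normrM. Qed.

Lemma cabsX z n : cabs (z ^+ n) = cabs z ^+ n.
Proof. by apply: complexI; rewrite rmorphXn /= !cabsE normrX. Qed.

Lemma cabsD z w : cabs (z + w) <= cabs z + cabs w.
Proof. by rewrite -lecR rmorphD /= !cabsE ler_normD. Qed.

Lemma cabsB z w : cabs (z - w) <= cabs z + cabs w.
Proof. by rewrite -lecR rmorphD /= !cabsE ler_normB. Qed.

Lemma cabs_real (x : R) : cabs x%:C = `|x|.
Proof. by rewrite /cabs normc_def /= expr0n addr0 sqrtr_sqr. Qed.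

Lemma cabs_cis (x : R) : cabs (cis x) = 1.
Proof. by apply: complexI; rewrite cabsE norm_cis. Qed.

Lemma ler_Re_cabs z : `|Re z| <= cabs z.
Proof. by rewrite -lecR cabsE normc_ge_Re. Qed.

Lemma ler_Im_cabs z : `|Im z| <= cabs z.
Proof.
rewrite /cabs normc_def /= -sqrtr_sqr ler_wsqrtr// lerDr; exact: sqr_ge0.
Qed.

Lemma cabs_le z : cabs z <= `|Re z| + `|Im z|.
Proof.
case: z => x y; rewrite -[x +i* y]/(Complex x y) (_ : Complex x y = x%:C + 'i * y%:C); last by simpc.
rewrite (le_trans (cabsD _ _))// cabsM !cabs_real; simpc => /=.
by rewrite /cabs normc_def /= expr0n add0r expr1n sqrtr1 mul1r.
Qed.

End Cabs.

Section Laplace.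
Context {R : realType}.
Implicit Types f g : R -> R.

Definition Lc f (a b : R) : R := Ir (fun t => f t * (expR (b * t) * cos (a * t))).
Definition Ls f (a b : R) : R := Ir (fun t => f t * (expR (b * t) * sin (a * t))).
(* The integral of [f t * exp ((b - i a) t)]; thus [cFT f (x + i y) = LT f (2 pi x) (2 pi y)]. *)
Definition LT f (a b : R) : R[i] := Lc f a b -i* Ls f a b.

Let exp_lin (b : R) (x : R) : is_derive x (1 : R) (fun t => expR (b * t)) (b * expR (b * x)).
Proof.
apply: (is_derive_eq (is_derive1_comp (is_derive_expR (b * x)) (is_deriveZ b (is_derive_id x (1 : R))))).
by rewrite /GRing.scale /= mulr1 mulrC.
Qed.

Lemma is_derive_kerc (a b x : R) :
  is_derive x (1 : R) (fun t => expR (b * t) * cos (a * t))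
    (b * (expR (b * x) * cos (a * x)) - a * (expR (b * x) * sin (a * x))).
Proof.
apply: (is_derive_eq (is_deriveM (exp_lin b x)
  (is_derive1_comp (is_derive_cos (a * x)) (is_deriveZ a (is_derive_id x (1 : R)))))).
rewrite /GRing.scale /=; ring.
Qed.

Lemma is_derive_kers (a b x : R) :
  is_derive x (1 : R) (fun t => expR (b * t) * sin (a * t))
    (b * (expR (b * x) * sin (a * x)) + a * (expR (b * x) * cos (a * x))).
Proof.
apply: (is_derive_eq (is_deriveM (exp_lin b x)
  (is_derive1_comp (is_derive_sin (a * x)) (is_deriveZ a (is_derive_id x (1 : R)))))).
rewrite /GRing.scale /=; ring.
Qed.

Lemma kerc_continuous (a b : R) : continuous (fun t : R => expR (b * t) * cos (a * t)).
Proof.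
by move=> x; apply/differentiable_continuous/derivable1_diffP; case: (is_derive_kerc a b x).
Qed.

Lemma kers_continuous (a b : R) : continuous (fun t : R => expR (b * t) * sin (a * t)).
Proof.
by move=> x; apply/differentiable_continuous/derivable1_diffP; case: (is_derive_kers a b x).
Qed.

Lemma ccc f a b : cc f -> cc (fun t => f t * (expR (b * t) * cos (a * t))).
Proof. by move=> ccf; apply: ccM => //; exact: kerc_continuous. Qed.

Lemma ccs f a b : cc f -> cc (fun t => f t * (expR (b * t) * sin (a * t))).
Proof. by move=> ccf; apply: ccM => //; exact: kers_continuous. Qed.

Lemma Lc_derive f a b : smooth f -> cc f ->
  Lc (derive1 f) a b = - b * Lc f a b + a * Ls f a b.
Proof.
move=> sf ccf.
have cc1 := ccc a b ccf; have cc2 := ccs a b ccf.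
have cc3 := ccc a b (cc_derive1 sf ccf).
have : Ir (fun t => derive1 f t * (expR (b * t) * cos (a * t)) +
   (b * (f t * (expR (b * t) * cos (a * t))) + - a * (f t * (expR (b * t) * sin (a * t))))) = 0.
  apply: (Ir_derive cc1).
    by apply: ccD => //; apply: ccD; apply: ccZ.
  move=> x; apply: (is_derive_eq (is_deriveM (smooth_is_derive x sf) (is_derive_kerc a b x))).
  rewrite /GRing.scale /=; ring.
rewrite IrD//; last by apply: ccD; apply: ccZ.
rewrite IrD; [|exact: ccZ|exact: ccZ].
rewrite !IrZ// -/(Lc _ _ _) -/(Ls _ _ _) -/(Lc _ _ _); lra.
Qed.

Lemma Ls_derive f a b : smooth f -> cc f ->
  Ls (derive1 f) a b = - b * Ls f a b - a * Lc f a b.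
Proof.
move=> sf ccf.
have cc1 := ccc a b ccf; have cc2 := ccs a b ccf.
have cc3 := ccs a b (cc_derive1 sf ccf).
have : Ir (fun t => derive1 f t * (expR (b * t) * sin (a * t)) +
   (b * (f t * (expR (b * t) * sin (a * t))) + a * (f t * (expR (b * t) * cos (a * t))))) = 0.
  apply: (Ir_derive cc2).
    by apply: ccD => //; apply: ccD; apply: ccZ.
  move=> x; apply: (is_derive_eq (is_deriveM (smooth_is_derive x sf) (is_derive_kers a b x))).
  rewrite /GRing.scale /=; ring.
rewrite IrD//; last by apply: ccD; apply: ccZ.
rewrite IrD; [|exact: ccZ|exact: ccZ].
rewrite !IrZ// -/(Lc _ _ _) -/(Ls _ _ _) -/(Ls _ _ _); lra.
Qed.

Lemma cc_derive1n f n : smooth f -> cc f -> cc (derive1n n f).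
Proof.
move=> sf ccf; elim: n => // n IH; rewrite derive1nS.
exact (cc_derive1 (@smooth_derive1n _ f n sf) IH).
Qed.

Lemma LT_derive1n f n a b : smooth f -> cc f ->
  LT (derive1n n f) a b = ((- b) +i* a) ^+ n * LT f a b.
Proof.
move=> sf ccf; elim: n => [|n IH]; first by rewrite expr0 mul1r.
have sn := @smooth_derive1n _ f n sf; have cn := cc_derive1n n sf ccf.
rewrite exprS -mulrA -IH derive1nS /LT Lc_derive// Ls_derive//.
by congr (_ +i* _); ring.
Qed.

Lemma LT_bound f M a b : cc f -> (forall t, M < `|t| -> f t = 0) ->
  cabs (LT f a b) <= 2 * (expR (M * `|b|) * Ir (fun t => `|f t|)).
Proof.
move=> ccf fM; have ccn := cc_norm ccf.
have H (k : R -> R) : continuous k -> (forall t, `|k t| <= expR (b * t)) ->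
    `|Ir (fun t => f t * k t)| <= expR (M * `|b|) * Ir (fun t => `|f t|).
  move=> ck kle; have cck := ccM ccf ck.
  rewrite (le_trans (le_norm_Ir cck))// -IrZ//; apply: le_Ir.
  - exact: cc_norm.
  - exact: ccZ.
  move=> t; rewrite normrM mulrC; have [Mt|tM] := ltP M `|t|.
    by rewrite fM// normr0 !mulr0.
  rewrite ler_wpM2r// (le_trans (kle t))// ler_expR.
  by rewrite (le_trans (ler_norm _))// normrM mulrC ler_wpM2r.
rewrite (le_trans (cabs_le _))// mulr_natl mulr2n /= normrN; apply: lerD.
  apply: H; first exact: kerc_continuous.
  move=> t; rewrite normrM ger0_norm ?expR_ge0// ler_piMr ?expR_ge0//.
  by rewrite ler_norml cos_geN1 cos_le1.
apply: H; first exact: kers_continuous.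
move=> t; rewrite normrM ger0_norm ?expR_ge0// ler_piMr ?expR_ge0//.
by rewrite ler_norml sin_geN1 sin_le1.
Qed.

Lemma expR_sub1_le (u v : R) : `|u| <= v -> `|expR u - 1| <= v * expR v.
Proof.
move=> uv; have v0 : 0 <= v by rewrite (le_trans _ uv).
have ev : 1 <= expR v by have := expR_ge1Dx v; lra.
move: uv; rewrite ler_norml => /andP[uv1 uv2].
rewrite ler_norml; apply/andP; split.
  have := expR_ge1Dx u; nra.
have e1 : expR u <= expR v by rewrite ler_expR.
have : (1 - v) * expR v <= 1.
  rewrite -[leRHS](expRxMexpNx_1 v) [leRHS]mulrC ler_wpM2r ?expR_ge0//.
  exact: expR_ge1Dx.
lra.
Qed.

Lemma LTB_bound f M a b : 0 <= M -> cc f -> (forall t, M < `|t| -> f t = 0) ->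
  cabs (LT f a b - LT f a 0) <= 2 * (M * `|b| * expR (M * `|b|) * Ir (fun t => `|f t|)).
Proof.
move=> M0 ccf fM; have ccn := cc_norm ccf.
have H (k : R -> R) : (forall b' : R, continuous (fun t : R => expR (b' * t) * k t)) ->
    (forall t, `|k t| <= 1) ->
    `|Ir (fun t => f t * (expR (b * t) * k t)) - Ir (fun t => f t * (expR (0 * t) * k t))|
    <= M * `|b| * expR (M * `|b|) * Ir (fun t => `|f t|).
  move=> ck kle; have cck b' := ccM ccf (ck b').
  have -> : Ir (fun t => f t * (expR (b * t) * k t)) - Ir (fun t => f t * (expR (0 * t) * k t)) =
    Ir (fun t => f t * (expR (b * t) * k t) + -1 * (f t * (expR (0 * t) * k t))).
    by rewrite IrD ?IrZ ?mulN1r//; exact: ccZ.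
  have cd : cc (fun t => f t * (expR (b * t) * k t) + -1 * (f t * (expR (0 * t) * k t))).
    by apply: ccD => //; exact: ccZ.
  rewrite (le_trans (le_norm_Ir cd))// -IrZ//; apply: le_Ir.
  - exact: cc_norm.
  - exact: ccZ.
  move=> t; rewrite mul0r expR0.
  have -> : f t * (expR (b * t) * k t) + -1 * (f t * (1 * k t)) =
    (expR (b * t) - 1) * k t * f t by ring.
  rewrite normrM; have [Mt|tM] := ltP M `|t|.
    by rewrite fM// normr0 !mulr0.
  rewrite ler_wpM2r// normrM -[leRHS]mulr1 ler_pM//.
  by apply: expR_sub1_le; rewrite normrM mulrC ler_wpM2r.
have E (x y : R) : - x - - y = - (x - y) by ring.
rewrite (le_trans (cabs_le _))// [X in _ <= X]mulr_natl mulr2n /= E normrN; apply: lerD.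
  apply: H; first by move=> b'; exact: kerc_continuous.
  by move=> t; rewrite ler_norml cos_geN1 cos_le1.
apply: H; first by move=> b'; exact: kers_continuous.
by move=> t; rewrite ler_norml sin_geN1 sin_le1.
Qed.

End Laplace.

(** * Decay of transforms in horizontal strips; effect of translation, dilation and modulation *)

Section Decay.
Context {R : realType}.
Implicit Types f g : R -> R.

Lemma pow1D_le (x : R) n : 0 <= x -> (1 + x) ^+ n <= 2 ^+ n * (1 + x ^+ n).
Proof.
move=> x0; have [x1|x1] := leP x 1.
  rewrite (@le_trans _ _ (2 ^+ n))//.
    by rewrite lerXn2r ?nnegrE//; lra.
  by rewrite ler_peMr ?exprn_ge0// lerDl exprn_ge0.
rewrite (@le_trans _ _ ((2 * x) ^+ n))//.
  by rewrite lerXn2r ?nnegrE//; lra.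
by rewrite exprMn ler_wpM2l ?exprn_ge0// lerDr.
Qed.

Lemma ler_norm_cabs (a b : R) : `|a| <= cabs (b +i* a).
Proof. exact: (ler_Im_cabs (b +i* a)). Qed.

Lemma cc_supp f : cc f -> exists2 M, 0 <= M & forall t, M < `|t| -> f t = 0.
Proof. by move=> ccf; have [M [/ltW M0 H]] := cc_vanish2 ccf ccf; exists M => // t /H[]. Qed.

(** [n] integrations by parts gain the factor |- b + i a|^n, which is at least |a|^n; the trivial
    bound [LT_bound] covers the remaining term of [pow1D_le]. *)
Lemma LT_decay f n (B : R) : smooth f -> cc f ->
  exists2 C, 0 <= C & forall a b, `|b| <= B -> cabs (LT f a b) * (1 + `|a|) ^+ n <= C.
Proof.
move=> sf ccf; have [M M0 fM] := cc_supp ccf.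
have [N N0 gN] := cc_supp (cc_derive1n n sf ccf).
pose C0 := 2 * (expR (M * B) * Ir (fun t => `|f t|)).
pose Cn := 2 * (expR (N * B) * Ir (fun t => `|derive1n n f t|)).
have I0 g : 0 <= Ir (fun t => `|g t|) by apply: Ir_ge0.
have C00 : 0 <= C0 by rewrite !mulr_ge0 ?expR_ge0 ?I0.
have Cn0 : 0 <= Cn by rewrite !mulr_ge0 ?expR_ge0 ?I0.
exists (2 ^+ n * (C0 + Cn)).
  by rewrite mulr_ge0 ?exprn_ge0 ?addr_ge0.
move=> a b bB; have c0 := cabs_ge0 (LT f a b).
rewrite (le_trans (ler_wpM2l c0 (pow1D_le n (normr_ge0 a))))// mulrCA.
rewrite ler_wpM2l ?exprn_ge0// mulrDr mulr1 lerD//.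
  rewrite (le_trans (LT_bound a b ccf fM))// /C0 ler_wpM2l// ler_wpM2r ?I0//.
  by rewrite ler_expR ler_wpM2l.
have := LT_bound a b (cc_derive1n n sf ccf) gN.
rewrite (LT_derive1n n a b sf ccf) cabsM cabsX mulrC => H.
apply: (@le_trans _ _ (cabs (LT f a b) * cabs (- b +i* a) ^+ n)).
  by rewrite ler_wpM2l// lerXn2r ?nnegrE// ?cabs_ge0// ler_norm_cabs.
rewrite mulrC (le_trans _ (le_trans H _))//; first by rewrite mulrC.
rewrite /Cn ler_wpM2l// ler_wpM2r ?I0//.
by rewrite ler_expR ler_wpM2l.
Qed.

Lemma cabs_subX (z w : R[i]) n : cabs w <= cabs z ->
  cabs (z ^+ n.+1 - w ^+ n.+1) <= cabs (z - w) * (n.+1%:R * cabs z ^+ n).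
Proof.
move=> wz; rewrite subrXX cabsM ler_wpM2l ?cabs_ge0//.
have cs (I : Type) (s : seq I) (F : I -> R[i]) : cabs (\sum_(i <- s) F i) <= \sum_(i <- s) cabs (F i).
  elim/big_rec2: _ => [|i y x _ h]; first by rewrite -[X in cabs X]/(0%:C) cabs_real normr0.
  by rewrite (le_trans (cabsD _ _))// lerD2l.
rewrite (le_trans (cs _ _ _))// -[n.+1 in leRHS]card_ord -sumr_const mulr_suml.
apply: ler_sum => i _; rewrite mul1r cabsM !cabsX.
have i_n : (i <= n)%N by rewrite -ltnS.
have -> : cabs z ^+ n = cabs z ^+ (n - i) * cabs z ^+ i by rewrite -exprD subnK.
rewrite ler_wpM2l ?exprn_ge0 ?cabs_ge0//.
by rewrite lerXn2r ?nnegrE ?cabs_ge0.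
Qed.

(** The transform at height [b] differs from its values on the real axis by O(|b|), with any
    polynomial decay in [a]. This is what makes a thin strip as good as the axis. *)
Lemma LTB_decay f n (B : R) : smooth f -> cc f ->
  exists2 C, 0 <= C & forall a b, `|b| <= B ->
    cabs (LT f a b - LT f a 0) * (1 + `|a|) ^+ n <= C * `|b|.
Proof.
move=> sf ccf; have [M M0 fM] := cc_supp ccf.
have sg := @smooth_derive1n _ f n.+1 sf; have ccg := cc_derive1n n.+1 sf ccf.
have [N N0 gN] := cc_supp ccg.
have [C0 C00 HC0] := LT_decay n 0 sf ccf.
pose I0 g := Ir (fun t : R => `|g t|).
have I00 g : 0 <= I0 g by apply: Ir_ge0.
pose C1 := 2 * (M * expR (M * B) * I0 f).
pose C2 := 2 * (N * expR (N * B) * I0 (derive1n n.+1 f)).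
have C10 : 0 <= C1 by rewrite !mulr_ge0 ?expR_ge0 ?I00.
have C20 : 0 <= C2 by rewrite !mulr_ge0 ?expR_ge0 ?I00.
pose C3 := n.+1%:R * ((1 + `|B|) ^+ n * C0).
have C30 : 0 <= C3 by rewrite !mulr_ge0 ?ler0n ?exprn_ge0 ?addr_ge0.
exists (2 ^+ n * (C1 + (C1 + C2 + C3))).
  by rewrite mulr_ge0 ?exprn_ge0 ?addr_ge0.
have bnd (L I b : R) : 0 <= L -> 0 <= I -> `|b| <= B ->
    2 * (L * `|b| * expR (L * `|b|) * I) <= 2 * (L * expR (L * B) * I) * `|b|.
  move=> L0 I1 bB; rewrite -!mulrA ler_wpM2l// ler_wpM2l//.
  have -> : expR (L * B) * (I * `|b|) = `|b| * (expR (L * B) * I) by ring.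
  by rewrite ler_wpM2l// ler_wpM2r// ler_expR ler_wpM2l.
move=> a b bB; set D := LT f a b - LT f a 0; have c0 := cabs_ge0 D.
have D1 : cabs D <= C1 * `|b|.
  by rewrite (le_trans (LTB_bound a b M0 ccf fM))// bnd ?I00.
rewrite (le_trans (ler_wpM2l c0 (pow1D_le n (normr_ge0 a))))// mulrCA -mulrA.
rewrite ler_wpM2l ?exprn_ge0// mulrDr mulr1 mulrDl lerD//.
have [a1|a1] := leP `|a| 1.
  rewrite (@le_trans _ _ (cabs D))//.
    by rewrite ler_piMr// exprn_ile1.
  by rewrite (le_trans D1)// ler_wpM2r// -addrA lerDl addr_ge0.
set w : R[i] := - b +i* a; set v : R[i] := - 0 +i* a.
have vw : cabs v <= cabs w.
  by rewrite /cabs !normc_def /= ler_wsqrtr// lerD2r oppr0 expr0n sqr_ge0.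
have aw : `|a| <= cabs w by exact: ler_norm_cabs.
have wv : cabs (w - v) = `|b|.
  rewrite (_ : w - v = (- b)%:C); first by rewrite cabs_real normrN.
  by apply/eqP; rewrite eq_complex /= oppr0 subr0 subrr !eqxx.
(* Multiplication by the powers of [w] and [v] turns the two transforms into those of the
   derivative, whose difference is O(|b|). The remaining difference of powers is O(|b| |w|^n), and
   the decay of order [n] of [LT f a 0] absorbs |w|^n. *)
have key : w ^+ n.+1 * D = (LT (derive1n n.+1 f) a b - LT (derive1n n.+1 f) a 0) -
    (w ^+ n.+1 - v ^+ n.+1) * LT f a 0.
  rewrite (LT_derive1n n.+1 a b sf ccf) (LT_derive1n n.+1 a 0 sf ccf) -/w -/v /D.
  by move: (LT f a b) (LT f a 0) (w ^+ n.+1) (v ^+ n.+1) => x y z u; ring.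
have H1 : cabs (LT (derive1n n.+1 f) a b - LT (derive1n n.+1 f) a 0) <= C2 * `|b|.
  by rewrite (le_trans (LTB_bound a b N0 ccg gN))// bnd ?I00.
have H2 : cabs ((w ^+ n.+1 - v ^+ n.+1) * LT f a 0) <= C3 * `|b|.
  rewrite cabsM (le_trans (ler_wpM2r (cabs_ge0 _) (cabs_subX n vw)))//.
  rewrite wv [leRHS]mulrC -mulrA ler_wpM2l// /C3 -!mulrA ler_wpM2l//.
  have := HC0 a 0; rewrite normr0 lexx => /(_ isT) HC.
  rewrite (@le_trans _ _ ((1 + `|B|) ^+ n * (cabs (LT f a 0) * (1 + `|a|) ^+ n)))//.
    rewrite [leRHS]mulrCA [leLHS]mulrC -exprMn ler_wpM2l ?cabs_ge0// lerXn2r ?nnegrE ?cabs_ge0 ?mulr_ge0 ?addr_ge0//.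
    rewrite (le_trans (cabs_le _))//= normrN.
    have bB' : `|b| <= `|B| by rewrite (le_trans bB)// ler_norm.
    have := normr_ge0 a; have := normr_ge0 b; nra.
  by rewrite ler_wpM2l// exprn_ge0// addr_ge0.
rewrite (@le_trans _ _ (cabs (w ^+ n.+1 * D)))//.
  rewrite cabsM mulrC ler_wpM2r ?cabs_ge0// cabsX.
  rewrite (@le_trans _ _ (cabs w ^+ n))//.
    by rewrite lerXn2r ?nnegrE ?cabs_ge0.
  by rewrite exprS ler_peMl ?exprn_ge0 ?cabs_ge0// (le_trans _ aw)// ltW.
rewrite key (le_trans (cabsB _ _))// [leRHS]mulrDl lerD// [leRHS]mulrDl (le_trans H1)// lerDr.
by rewrite mulr_ge0.
Qed.

(** Substitution in the integral splits exp(-(b - i a) c) off the kernel. Its modulus exp(- b c) is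
    the cost of translating off the real axis, and the source of the exponential growth in the
    theorem. *)
Lemma LT_shift f (c a b : R) : cc f ->
  LT (fun t => f (t + c)) a b = (expR (- (b * c)))%:C * cis (a * c) * LT f a b.
Proof.
move=> ccf; have h1 := ccc a b ccf; have h2 := ccs a b ccf.
have E (k : R -> R) (x y : R) :
    (forall t, k t = x * (expR (b * (t + c)) * cos (a * (t + c))) +
                     y * (expR (b * (t + c)) * sin (a * (t + c)))) ->
    Ir (fun t => f (t + c) * k t) = x * Lc f a b + y * Ls f a b.
  move=> kE; rewrite -IrZ// -IrZ// -IrD; [|exact: ccZ|exact: ccZ].
  rewrite -[RHS]mul1r -invr1 -(Ir_affine c ltr01); last by apply: ccD; apply: ccZ.
  by congr Ir; apply/funext => t; rewrite kE mul1r; ring.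
have eb t : expR (b * t) = expR (- (b * c)) * expR (b * (t + c)).
  by rewrite -expRD; congr expR; ring.
have at_ t : a * t = a * (t + c) - a * c by ring.
set ec := expR (- (b * c)).
have Ec : Lc (fun t => f (t + c)) a b = ec * cos (a * c) * Lc f a b + ec * sin (a * c) * Ls f a b.
  by apply: E => t; rewrite eb at_ cosB -/ec; ring.
have Es : Ls (fun t => f (t + c)) a b = - (ec * sin (a * c)) * Lc f a b + ec * cos (a * c) * Ls f a b.
  by apply: E => t; rewrite eb at_ sinB -/ec; ring.
rewrite /LT Ec Es /cis; simpc; congr (_ +i* _); ring.
Qed.

Lemma LT_scale f (c a b : R) : 0 < c -> cc f ->
  LT (fun t => f (c * t)) a b = (c^-1)%:C * LT f (a / c) (b / c).
Proof.
move=> c0 ccf.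
have E (k : R -> R) : cc (fun t => f t * k t) ->
    Ir (fun t => f (c * t) * k (c * t)) = c^-1 * Ir (fun t => f t * k t).
  move=> cck; rewrite -(Ir_affine 0 c0 cck).
  by congr Ir; apply/funext => t; rewrite addr0.
have cK t (x : R) : x / c * (c * t) = x * t by field; rewrite gt_eqF.
have Ec := E _ (ccc (a / c) (b / c) ccf); have Es := E _ (ccs (a / c) (b / c) ccf).
have Ec' : Lc (fun t => f (c * t)) a b = c^-1 * Lc f (a / c) (b / c).
  by rewrite -Ec; congr Ir; apply/funext => t; rewrite !cK.
have Es' : Ls (fun t => f (c * t)) a b = c^-1 * Ls f (a / c) (b / c).
  by rewrite -Es; congr Ir; apply/funext => t; rewrite !cK.
by rewrite /LT Ec' Es'; simpc.
Qed.

Lemma LTD f g a b : cc f -> cc g -> LT (fun t => f t + g t) a b = LT f a b + LT g a b.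
Proof.
move=> cf cg; rewrite /LT; simpc; congr (_ +i* _).
  rewrite /Lc -IrD; [|exact: ccc|exact: ccc].
  by congr Ir; apply/funext => t; ring.
rewrite /Ls -opprD -IrD; [|exact: ccs|exact: ccs].
by congr (- Ir _); apply/funext => t; ring.
Qed.

Lemma LTZ f c a b : cc f -> LT (fun t => c * f t) a b = c%:C * LT f a b.
Proof.
move=> cf; rewrite /LT; simpc; congr (_ +i* _).
  by rewrite /Lc -IrZ; [congr Ir; apply/funext => t; ring|exact: ccc].
by rewrite ?mulrN; congr (- _); rewrite /Ls -IrZ; [congr Ir; apply/funext => t; ring|exact: ccs].
Qed.

Lemma cc0 : cc (fun _ : R => 0 : R).
Proof. by split; [move=> x; exact: cvg_cst|exists 0]. Qed.

Lemma cc_sum (I : Type) (s : seq I) (F : I -> R -> R) :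
  (forall i, cc (F i)) -> cc (fun t => \sum_(i <- s) F i t).
Proof.
move=> cF; elim: s => [|i s IH].
  by rewrite (_ : (fun _ => _) = (fun=> 0)); [exact: cc0|apply/funext => x; rewrite big_nil].
rewrite (_ : (fun _ => _) = (fun x => F i x + \sum_(i <- s) F i x)); first exact: ccD.
by apply/funext => x; rewrite big_cons.
Qed.

Lemma LT_sum (I : Type) (s : seq I) (F : I -> R -> R) a b :
  (forall i, cc (F i)) -> LT (fun t => \sum_(i <- s) F i t) a b = \sum_(i <- s) LT (F i) a b.
Proof.
move=> cF; elim: s => [|i s IH].
  rewrite big_nil (_ : (fun _ => _) = (fun t => 0 * 0)).
    by rewrite LTZ ?rmorph0 ?mul0r//; exact: cc0.
  by apply/funext => x; rewrite big_nil mul0r.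
rewrite big_cons -IH -LTD; [|exact: cF|exact: cc_sum].
by congr LT; apply/funext => x; rewrite big_cons.
Qed.

Lemma cFT_LT f (s : R) (p : R * R) : cc f ->
  cFT (fun t => (f t)%:C * cis (s * t)) (cpt p) = LT f (2 * pi * p.1 - s) (2 * pi * p.2).
Proof.
move=> ccf; have cisE t : cis (s * t) * cexp ((- (2 * pi * t))%:C * 'i * cpt p) =
   (expR (2 * pi * p.2 * t))%:C * cis (- ((2 * pi * p.1 - s) * t)).
  have -> : cexp ((- (2 * pi * t))%:C * 'i * cpt p) =
      (expR (2 * pi * p.2 * t))%:C * cis (- (2 * pi * p.1 * t)).
    rewrite /cexp /cis /cpt; simpc; rewrite /=.
    by congr (expR _ * cos _ +i* (expR _ * sin _)); ring.
  by rewrite mulrCA -cisD; congr (_ * cis _); ring.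
rewrite /cFT /cintegral /LT; congr (_ +i* _).
  rewrite /Lc /Ir; congr Rintegral; apply/funext => t.
  by rewrite -mulrA cisE /cis; simpc => /=; rewrite cosN.
rewrite -mulN1r /Ls -IrZ; last exact: ccs.
rewrite /Ir; congr Rintegral; apply/funext => t.
by rewrite -mulrA cisE /cis; simpc => /=; rewrite sinN; ring.
Qed.

End Decay.

(** * Integration over the strip *)

Section UnmeasurableIntegral.
Context {d : measure_display} {T : measurableType d} {R : realType}.
Variable nu : {measure set T -> \bar R}.

(* The integral of a nonnegative function is a supremum over the simple functions below it, hence monotone
   without any measurability assumption. *)
Lemma ge0_le_integralT (f g : T -> \bar R) : (forall x, (0 <= f x)%E) -> (forall x, (f x <= g x)%E) ->
  (\int[nu]_x f x <= \int[nu]_x g x)%E.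
Proof.
move=> f0 fg; rewrite !ge0_integralTE//; last first.
  by move=> x; exact: le_trans (f0 x) (fg x).
apply: le_ereal_sup => _ [h /= hf <-]; exists h => //= x.
exact: le_trans (hf x) (fg x).
Qed.

(** [f] lies below the sum of the step functions [c n] on [E n], and only these measurable functions
    are integrated term by term. The value +oo is allowed for [c n], which is harmless on a null
    set. *)
Lemma integral_le_cover (E : nat -> set T) (c : nat -> \bar R) (f : T -> \bar R) :
  (forall n, measurable (E n)) -> (forall n, (0 <= c n)%E) -> (forall x, (0 <= f x)%E) ->
  (forall x, exists2 n, E n x & (f x <= c n)%E) ->
  (\int[nu]_x f x <= \sum_(n <oo) c n * nu (E n))%E.
Proof.
move=> mE c0 f0 fc.
pose g n : T -> \bar R := (cst (c n)) \_ (E n).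
have g0 n x : (0 <= g n x)%E by rewrite /g patchE; case: ifP => _; [exact: c0|exact: lexx].
apply: (@le_trans _ _ (\int[nu]_x (\sum_(n <oo) g n x))%E).
  apply: ge0_le_integralT => // x; have [n Enx fn] := fc x.
  apply: le_trans fn _; apply: (@le_trans _ _ (\sum_(0 <= i < n.+1) g i x)%E).
    rewrite big_nat_recr//= {2}/g patchE mem_set//= leeDr// sume_ge0//.
  exact: nneseries_lim_ge.
rewrite integral_nneseries//; last first.
  by move=> n; apply/(measurable_restrictT _ (mE n)); exact: measurable_cst.
apply: lee_nneseries => [n _ _|n _]; first by apply: integral_ge0.
by rewrite /g -integral_mkcond integral_cst.
Qed.

Lemma Rintegral_posneg (f : T -> R) : Rintegral nu setT f =
  fine (\int[nu]_x (Num.max (f x) 0)%:E - \int[nu]_x (Num.max (- f x) 0)%:E)%E.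
Proof.
rewrite /Rintegral integralE; congr (fine (_ - _)); apply: eq_integral => x _.
  by rewrite funeposE /= EFin_max.
by rewrite funenegE /= EFin_max.
Qed.

(** The two bounds make both parts finite, so that the real-valued integral is truly their
    difference; without finiteness [fine] could return its default 0. *)
Lemma Rintegral_pos_le (f : T -> R) (C a : R) :
  (\int[nu]_x (Num.max (f x) 0)%:E <= C%:E)%E ->
  (\int[nu]_x (Num.max (- f x) 0)%:E <= a%:E)%E ->
  (\int[nu]_x (Num.max (f x) 0)%:E <= (Rintegral nu setT f + a)%:E)%E.
Proof.
move=> fC fa; rewrite Rintegral_posneg.
set I1 := (\int[nu]_x (Num.max (f x) 0)%:E)%E in fC *.
set I2 := (\int[nu]_x (Num.max (- f x) 0)%:E)%E in fa *.
have I10 : (0 <= I1)%E by apply: integral_ge0 => x _; rewrite lee_fin le_max lexx orbT.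
have I20 : (0 <= I2)%E by apply: integral_ge0 => x _; rewrite lee_fin le_max lexx orbT.
have f1 : I1 \is a fin_num by rewrite ge0_fin_numE// (le_lt_trans fC)// ltry.
have f2 : I2 \is a fin_num by rewrite ge0_fin_numE// (le_lt_trans fa)// ltry.
move: fa; rewrite -(fineK f1) -(fineK f2) !lee_fin /=; lra.
Qed.

Lemma Rintegral_abs_le (f : T -> R) (g : T -> \bar R) (C : R) :
  (forall x, (`|f x|%:E <= g x)%E) -> (\int[nu]_x g x <= C%:E)%E ->
  `|Rintegral nu setT f| <= C.
Proof.
move=> fg gC.
have H (k : T -> R) : (forall x, k x <= `|f x|) -> (\int[nu]_x (Num.max (k x) 0)%:E <= C%:E)%E.
  move=> kf; apply: le_trans gC; apply: ge0_le_integralT => x.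
    by rewrite lee_fin le_max lexx orbT.
  by rewrite (le_trans _ (fg x))// lee_fin ge_max kf normr_ge0.
have h1 := H f (fun x => ler_norm (f x)).
have h2 : (\int[nu]_x (Num.max (- f x) 0)%:E <= C%:E)%E.
  by apply: H => x; rewrite -normrN ler_norm.
have I1 : (0 <= \int[nu]_x (Num.max (f x) 0)%:E)%E.
  by apply: integral_ge0 => x _; rewrite lee_fin le_max lexx orbT.
have I2 : (0 <= \int[nu]_x (Num.max (- f x) 0)%:E)%E.
  by apply: integral_ge0 => x _; rewrite lee_fin le_max lexx orbT.
rewrite ler_norml; apply/andP; split.
  have := le_trans I1 (Rintegral_pos_le h1 h2); rewrite lee_fin; lra.
rewrite Rintegral_posneg.
have f1 : (\int[nu]_x (Num.max (f x) 0)%:E)%E \is a fin_num.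
  by rewrite ge0_fin_numE// (le_lt_trans h1)// ltry.
have f2 : (\int[nu]_x (Num.max (- f x) 0)%:E)%E \is a fin_num.
  by rewrite ge0_fin_numE// (le_lt_trans h2)// ltry.
move: h1 I2; rewrite -(fineK f1) -(fineK f2) !lee_fin /=; lra.
Qed.

End UnmeasurableIntegral.

Section Band.
Context {R : realType}.
Variables (H : R) (nu : {measure set (R * R) -> \bar R}) (L : R).
Hypothesis nuH : nu (~` strip H) = 0%E.
Hypothesis L0 : 0 < L.

Definition band (s : R) : set (R * R) := [set p | strip H p /\ `|p.1 - s| <= L].

Let shell (s : R) (k : nat) : set (R * R) :=
  [set p | strip H p /\ k%:R <= `|p.1 - s| / L < k.+1%:R].

Lemma measurable_strip : measurable (strip H : set (R * R)).
Proof.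
have -> : strip H = [set: R * R] `&` (fun p : R * R => `|p.2|) @^-1` `]-oo, H].
  by rewrite setTI; apply/seteqP; split => p; rewrite /strip /= in_itv.
have mf : measurable_fun [set: R * R] (fun p : R * R => `|p.2|).
  by apply: measurableT_comp => //; exact: measurable_snd.
exact: mf.
Qed.

Let mabs s : measurable_fun [set: R * R] (fun p : R * R => `|p.1 - s|).
Proof.
apply: measurableT_comp => //; apply: measurable_funB => //; exact: measurable_fst.
Qed.

Lemma measurable_band s : measurable (band s : set (R * R)).
Proof.
have -> : band s = strip H `&` ([set: R * R] `&` (fun p : R * R => `|p.1 - s|) @^-1` `]-oo, L]).
  by rewrite setTI; apply/seteqP; split => p; rewrite /band /= in_itv.
by apply: measurableI; [exact: measurable_strip|exact: mabs].
Qed.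

Let measurable_shell s k : measurable (shell s k : set (R * R)).
Proof.
have -> : shell s k = strip H `&`
    ([set: R * R] `&` (fun p : R * R => `|p.1 - s|) @^-1` `[k%:R * L, k.+1%:R * L[).
  rewrite setTI; apply/seteqP; split => p; rewrite /shell /= in_itv /=;
    by rewrite ler_pdivlMr// ltr_pdivrMr.
by apply: measurableI; [exact: measurable_strip|exact: mabs].
Qed.

Variables (N : nat) (alpha beta : R).
Hypotheses (alpha0 : 0 <= alpha) (beta0 : 0 <= beta).
Hypothesis bandle : forall s, (nu (band s) <= (alpha + beta * (1 + `|s| / L) ^+ N)%:E)%E.

(** The [k]-th shell lies in the bands centred at [s + k L] and [s - k L], hence the factor 2, and 1
    + |s'|/L is at most (1 + |s|/L)(1 + k) at both centres. *)
Let shell_le s k :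
  (nu (shell s k) <= (2 * (alpha + beta * (1 + `|s| / L) ^+ N) * (1 + k%:R) ^+ N)%:E)%E.
Proof.
have sub : shell s k `<=` band (s + k%:R * L) `|` band (s - k%:R * L).
  move=> p [pH]; rewrite ler_pdivlMr// ltr_pdivrMr// -natr1 mulrDl mul1r => /andP[].
  case: (ger0P (p.1 - s)) => ps k1 k2.
    by left; split => //; rewrite ler_norml; apply/andP; split; lra.
  by right; split => //; rewrite ler_norml; apply/andP; split; lra.
have le1 s' : `|s'| <= `|s| + k%:R * L ->
   (nu (band s') <= ((alpha + beta * (1 + `|s| / L) ^+ N) * (1 + k%:R) ^+ N)%:E)%E.
  move=> ss'; rewrite (le_trans (bandle s'))// lee_fin mulrDl lerD//.
    by rewrite ler_peMr// exprn_ege1// lerDl.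
  rewrite -mulrA ler_wpM2l// -exprMn lerXn2r ?nnegrE ?mulr_ge0 ?addr_ge0 ?divr_ge0 ?(ltW L0)//.
  have h1 : `|s'| / L <= `|s| / L + k%:R by rewrite ler_pdivrMr// mulrDl divfK ?gt_eqF.
  have h2 : 0 <= `|s| / L * k%:R by rewrite mulr_ge0 ?divr_ge0 ?(ltW L0).
  lra.
apply: (le_trans (le_measure _ _ _ sub)); rewrite ?inE//.
  by apply: measurableU; exact: measurable_band.
apply: (le_trans (measureU2 _ (measurable_band _) (measurable_band _))).
have twice (x y : R) : 2 * x * y = x * y + x * y by ring.
rewrite twice EFinD; apply: leeD; apply: le1.
  by rewrite (le_trans (ler_normD _ _))// lerD2l ger0_norm// mulr_ge0// ltW.
by rewrite (le_trans (ler_normB _ _))// lerD2l ger0_norm// mulr_ge0// ltW.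
Qed.

(** The subtracted 1/n makes the induction telescope; at [n = 0] it is 0 by convention. *)
Lemma sum_inv_sq (n : nat) : \sum_(0 <= k < n) (1 + k%:R) ^- 2 <= 2 - n%:R^-1 :> R.
Proof.
case: n => [|n]; first by rewrite big_nil invr0 subr0.
elim: n => [|n IH]; first by rewrite big_nat1 addr0 expr1n invr1; lra.
rewrite big_nat_recr//= (le_trans (lerD IH (lexx _)))//.
have n0 : (0 : R) < n.+1%:R by rewrite ltr0n.
have -> : 1 + n.+1%:R = n.+2%:R :> R by rewrite addrC natr1.
have e : n.+2%:R = n.+1%:R + 1 :> R by rewrite natr1.
rewrite e; move: n.+1%:R n0 => x x0.
have -> : 2 - (x + 1)^-1 = 2 - x^-1 + (x * (x + 1))^-1 by field; rewrite !gt_eqF//; lra.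
by rewrite lerD2l lef_pV2 ?posrE ?mulr_gt0 ?exprn_gt0//; nra.
Qed.

(** On the [k]-th shell [f] is at most e (1 + k)^-(N+2) and the mass at most 2 W (1 + k)^N, where W
    is the bound at [s]. Two orders of decay remain, the sum of (1 + k)^-2 is at most 2, and this
    gives the factor 4. *)
Lemma band_integral (f : R * R -> \bar R) (s e : R) : 0 <= e -> (forall p, (0 <= f p)%E) ->
  (forall p, strip H p -> (f p * ((1 + `|p.1 - s| / L) ^+ N.+2)%:E <= e%:E)%E) ->
  (\int[nu]_p f p <= (4 * e * (alpha + beta * (1 + `|s| / L) ^+ N))%:E)%E.
Proof.
move=> e0 f0 fe.
(* Off the strip nothing is known about [f], so the piece of index 0 carries the value +oo; its mass
   is 0 and the product is 0. *)
pose E n := if n is k.+1 then shell s k else ~` strip H.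
pose c n : \bar R := if n is k.+1 then (e / (1 + k%:R) ^+ N.+2)%:E else +oo%E.
apply: le_trans (@integral_le_cover _ _ _ nu E c f _ _ f0 _) _.
- by case=> [|k]; [exact: measurableC measurable_strip|exact: measurable_shell].
- by case=> [|k]; rewrite /c ?leey// lee_fin divr_ge0// exprn_ge0// addr_ge0.
- move=> p; have [pH|pH] := pselect (strip H p); last by exists 0%N => //; rewrite /c leey.
  pose k := Num.truncn (`|p.1 - s| / L).
  have x0 : 0 <= `|p.1 - s| / L by rewrite divr_ge0// ltW.
  have /andP[k1 k2] := truncn_itv x0.
  exists k.+1; first by split => //; rewrite k1 k2.
  have := fe p pH; rewrite /c.
  case: (f p) (f0 p) => [r r0|_|//]; last first.
    rewrite gt0_mulye ?leye_eq// lte_fin exprn_gt0//; lra.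
  rewrite -EFinM !lee_fin => re.
  rewrite ler_pdivlMr ?exprn_gt0 ?ltr_wpDr// (le_trans _ re)// ler_wpM2l//.
  by rewrite lerXn2r ?nnegrE ?addr_ge0// lerD2l.
set W := alpha + _.
have W0 : 0 <= W by rewrite addr_ge0// mulr_ge0// exprn_ge0// addr_ge0// divr_ge0// ltW.
apply: lime_le.
  apply: is_cvg_nneseries => n _ _; apply: mule_ge0 => //.
  by case: n => [|k]; rewrite /c ?leey// lee_fin divr_ge0// exprn_ge0// addr_ge0.
near=> n => /=; apply: (@le_trans _ _ (\sum_(0 <= k < n.+1) (c k * nu (E k)))%E).
  rewrite big_nat_recr//= leeDl//; apply: mule_ge0 => //.
  by case: (n) => [|k]; rewrite /c ?leey// lee_fin divr_ge0// exprn_ge0// addr_ge0.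
rewrite big_nat_recl//= nuH mule0 add0e.
apply: (@le_trans _ _ (\sum_(0 <= k < n) (2 * e * W * (1 + k%:R) ^- 2)%:E)%E).
  apply: lee_sum => k _; apply: (le_trans (lee_wpmul2l _ (shell_le s k))).
    by rewrite lee_fin divr_ge0// exprn_ge0// addr_ge0.
  rewrite -EFinM lee_fin -/W.
  have k0 : 0 < 1 + k%:R :> R by rewrite ltr_wpDr.
  rewrite -[N.+2]addn2 exprD invfM.
  have : (1 + k%:R) ^+ N != 0 :> R by rewrite gt_eqF// exprn_gt0.
  have : (1 + k%:R) ^+ 2 != 0 :> R by rewrite gt_eqF// exprn_gt0.
  move: ((1 + k%:R) ^+ N) ((1 + k%:R) ^+ 2) => u v v0 u0.
  rewrite le_eqVlt; apply/orP; left; apply/eqP; field; by rewrite u0 v0.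
rewrite sumEFin lee_fin -mulr_sumr.
have -> : 4 * e * W = 2 * e * W * 2 by ring.
rewrite ler_wpM2l ?mulr_ge0// (le_trans (sum_inv_sq n))// gerBl invr_ge0//.
Unshelve. all: by end_near. Qed.

End Band.

(** * A test function whose transform is almost positive *)

Section RiemannSum.
Context {R : realType}.
Implicit Types f g : R -> R.

Lemma MVT_all f g (a b : R) : (forall x : R, is_derive x (1 : R) f (g x)) -> a < b ->
  exists2 c, a < c < b & f b - f a = g c * (b - a).
Proof.
move=> df ab; have cf : {within `[a, b], continuous f}.
  apply: continuous_subspaceT => x.
  by apply/differentiable_continuous/derivable1_diffP; case: (df x).
have [c cab ->] := @MVT R f g a b ab (fun x _ => df x) cf.
by exists c => //; move: cab; rewrite in_itv.
Qed.

Lemma MVT_norm_le f g (K a b : R) : (forall x : R, is_derive x (1 : R) f (g x)) ->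
  (forall x, `|g x| <= K) -> `|f b - f a| <= K * `|b - a|.
Proof.
move=> df gK; wlog ab : a b / a < b => [hw|].
  case: (ltgtP a b) => [/hw//|/hw h|->]; first by rewrite distrC [X in _ * X]distrC.
  by rewrite !subrr normr0 mulr0.
by have [c _ ->] := MVT_all df ab; rewrite normrM ler_wpM2r.
Qed.

(** On each of the [n + 1] subintervals the mean value theorem gives the integral as a value of [f]
    times the length; moving that value to the left endpoint costs at most K/(n+1). *)
Lemma riemann_sum_error f g (K : R) (n : nat) : cc f ->
  (forall t, ~~ (0 < t < 1) -> f t = 0) ->
  (forall x : R, is_derive x (1 : R) f (g x)) -> (forall x, `|g x| <= K) ->
  `|Ir f - n.+1%:R^-1 * \sum_(j < n.+1) f (j%:R / n.+1%:R)| <= K / n.+1%:R.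
Proof.
move=> ccf f01 df gK; have [F dF] := cc_antiderivative ccf.
have fM t : 1 < `|t| -> f t = 0.
  move=> t1; apply: f01; apply: contraL t1 => /andP[t0 t1].
  by rewrite -leNgt ger0_norm ltW.
have lt11 : -1 < 1 :> R by lra.
rewrite (Ir_FTC ccf.1 fM (lexx _) (lexx _) lt11 dF).
have F0 : F 0 = F (-1).
  have [|c /andP[_ c0] H] := @MVT_all F f (-1) 0 dF; first by lra.
  by apply/eqP; rewrite -subr_eq0 H f01 ?mul0r// negb_and -leNgt ltW.
set m := n.+1%:R : R; have m0 : 0 < m by rewrite ltr0n.
have -> : F 1 - F (-1) = \sum_(0 <= j < n.+1) (F (j.+1%:R / m) - F (j%:R / m)).
  by rewrite (telescope_sumr (fun j => F (j%:R / m)))// -/m divff ?gt_eqF// mul0r F0.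
rewrite big_mkord mulr_sumr -sumrB (le_trans (ler_norm_sum _ _ _))//.
have -> : K / m = \sum_(j < n.+1) (K / m / m).
  by rewrite sumr_const card_ord -mulr_natr -/m divfK ?gt_eqF.
apply: ler_sum => j _.
have jj : (j : nat)%:R / m < j.+1%:R / m by rewrite ltr_pM2r ?invr_gt0// ltr_nat.
have dj : j.+1%:R / m - j%:R / m = m^-1.
  by rewrite -mulrBl -natrB// subSnn mul1r.
have [c /andP[c1 c2] ->] := MVT_all dF jj.
rewrite dj [X in _ - X]mulrC -mulrBl normrM [`|m^-1|]gtr0_norm ?invr_gt0//.
rewrite ler_wpM2r ?invr_ge0 ?(ltW m0)// (le_trans (MVT_norm_le _ _ df gK))//.
rewrite ler_wpM2l ?(le_trans _ (gK 0))// ger0_norm ?subr_ge0 ?ltW//.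
by move: c2; rewrite -(ltrD2r (- (j%:R / m))) dj.
Qed.

End RiemannSum.

Section Autocorrelation.
Context {R : realType}.

Lemma cc_hump : cc (hump : R -> R).
Proof.
split; first exact (smooth_continuous (@smooth_hump R)).
exists 1 => t t1; apply: hump_out; apply: contraL t1 => /andP[t0 t1].
by rewrite -leNgt ger0_norm ltW.
Qed.

(* A Riemann sum for the autocorrelation of [hump], whose transform is nonnegative on the real axis; a finite
   sum of translates is smooth for trivial reasons, and nonnegativity is only needed up to a small error. *)
Definition acor (n : nat) (t : R) : R :=
  n.+1%:R^-1 * \sum_(j < n.+1) hump (j%:R / n.+1%:R) * hump (t + j%:R / n.+1%:R).

Let cc_shift (c : R) : cc (fun t : R => hump (t + c)).
Proof.
have := cc_affine c ltr01 cc_hump.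
by under eq_fun do rewrite mul1r.
Qed.

Let cc_terms n : forall j : 'I_n.+1, cc (fun t : R => hump (j%:R / n.+1%:R) * hump (t + j%:R / n.+1%:R)).
Proof. by move=> j; apply: ccZ; exact: cc_shift. Qed.

Lemma cc_acor n : cc (acor n).
Proof. by apply: ccZ; apply: cc_sum; exact: cc_terms. Qed.

Lemma smooth_acor n : smooth (acor n).
Proof.
apply: smoothM; first exact (@smooth_cst _ _).
apply: smooth_sum => j; apply: smoothM; first exact (@smooth_cst _ _).
have := @smooth_affine R _ 1 (j%:R / n.+1%:R) (@smooth_hump R).
by under eq_fun do rewrite mul1r.
Qed.

Let hump_vanish (k : R -> R) : forall t, ~~ (0 < t < 1) -> hump t * k t = 0.
Proof. by move=> t /hump_out ->; rewrite mul0r. Qed.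

Lemma bounded_cc (f : R -> R) : cc f -> exists2 K, 0 <= K & forall t, `|f t| <= K.
Proof.
move=> [cf [M fM]].
have : compact (f @` `[- M, M]).
  apply: continuous_compact; first exact: continuous_subspaceT.
  exact: segment_compact.
move=> /compact_bounded [K [Kreal KH]].
exists (`|K| + 1); first by rewrite addr_ge0.
move=> t; have [Mt|tM] := ltP M `|t|; first by rewrite fM// normr0 addr_ge0.
apply: (KH (`|K| + 1)); first by rewrite (le_lt_trans (ler_norm K))// ltrDl.
by exists t => //=; rewrite in_itv /= -ler_norml.
Qed.

Let RS (a : R) (k : R -> R) n :=
  n.+1%:R^-1 * \sum_(j < n.+1) (hump (j%:R / n.+1%:R) * (expR (0 * (j%:R / n.+1%:R)) * k (a * (j%:R / n.+1%:R)))).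

(** Each translate contributes a phase, and the phases add up to a Riemann sum for the conjugate of
    [LT hump a 0]. The product is therefore close to |LT hump a 0|^2. *)
Lemma LT_acor n (a : R) : LT (acor n) a 0 = (RS a cos n +i* RS a sin n) * LT hump a 0.
Proof.
rewrite /acor LTZ; last by apply: cc_sum; exact: cc_terms.
rewrite LT_sum; last exact: cc_terms.
rewrite (eq_bigr (fun j : 'I_n.+1 =>
  (hump (j%:R / n.+1%:R))%:C * cis (a * (j%:R / n.+1%:R)) * LT hump a 0)); last first.
  move=> j _; rewrite LTZ; last exact: cc_shift.
  rewrite LT_shift; last exact: cc_hump.
  by rewrite mul0r oppr0 expR0 rmorph1 mul1r mulrA.
rewrite -mulr_suml mulrA; congr (_ * _).
have -> : \sum_(j < n.+1) (hump (j%:R / n.+1%:R))%:C * cis (a * (j%:R / n.+1%:R)) =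
    (\sum_(j < n.+1) hump (j%:R / n.+1%:R) * cos (a * (j%:R / n.+1%:R))) +i*
    (\sum_(j < n.+1) hump (j%:R / n.+1%:R) * sin (a * (j%:R / n.+1%:R))).
  apply/eqP; rewrite eq_complex !raddf_sum /=; apply/andP; split; apply/eqP;
    by apply: eq_bigr => j _; rewrite /= mul0r ?subr0 ?addr0.
rewrite /RS; simpc; congr (_ * _ +i* (_ * _));
  by apply: eq_bigr => j _; rewrite mul0r expR0 mul1r.
Qed.

(** The error is governed by the derivative of the integrand, which the oscillating factor makes
    grow like 1 + |a|; later one extra order of decay of [LT hump] pays for this. *)
Let RS_error : exists2 K : R, 0 <= K & forall n (a : R),
  `|Lc hump a 0 - RS a cos n| <= K * (1 + `|a|) / n.+1%:R /\
  `|Ls hump a 0 - RS a sin n| <= K * (1 + `|a|) / n.+1%:R.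
Proof.
have sh := @smooth_hump R.
have [K K0 HK] := bounded_cc (cc_derive1 sh cc_hump).
have h1 (t : R) : `|hump t| <= 1 by rewrite ger0_norm ?hump_ge0 ?hump_le1.
exists (K + 1); first by rewrite addr_ge0.
have le (u v w a : R) : `|u| <= K -> `|v| <= 1 -> `|w| <= 1 -> forall x, `|x| <= 1 ->
    `|x * (a * w) + v * u| <= (K + 1) * (1 + `|a|).
  move=> uK v1 w1 x x1; rewrite (le_trans (ler_normD _ _))// !normrM.
  have := normr_ge0 u; have := normr_ge0 v; have := normr_ge0 w; have := normr_ge0 a; have := normr_ge0 x.
  move=> x0 a0 w0 v0 u0.
  have p1 : `|v| * `|u| <= K by nra.
  have p2 : `|x| * (`|a| * `|w|) <= `|a|.
    rewrite mulrCA -[leRHS]mulr1 ler_wpM2l//; nra.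
  nra.
have c1 (t : R) : `|cos t| <= 1 by rewrite ler_norml cos_geN1 cos_le1.
have s1 (t : R) : `|sin t| <= 1 by rewrite ler_norml sin_geN1 sin_le1.
move=> n a; split.
  apply: (riemann_sum_error (g := fun x => hump x * (0 * (expR (0 * x) * cos (a * x)) -
      a * (expR (0 * x) * sin (a * x))) + (expR (0 * x) * cos (a * x)) * derive1 hump x)).
  - exact: ccc cc_hump.
  - exact: hump_vanish.
  - by move=> x; exact (is_deriveM (smooth_is_derive x sh) (is_derive_kerc a 0 x)).
  - move=> x; rewrite !mul0r sub0r expR0 !mul1r -mulrN.
    by apply: le; rewrite ?normrN.
apply: (riemann_sum_error (g := fun x => hump x * (0 * (expR (0 * x) * sin (a * x)) +
    a * (expR (0 * x) * cos (a * x))) + (expR (0 * x) * sin (a * x)) * derive1 hump x)).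
- exact: ccs cc_hump.
- exact: hump_vanish.
- by move=> x; exact (is_deriveM (smooth_is_derive x sh) (is_derive_kers a 0 x)).
- move=> x; rewrite !mul0r add0r expR0 !mul1r.
  by apply: le.
Qed.

Lemma Ir_hump_gt0 : 0 < Ir (hump : R -> R).
Proof.
have [F dF] := cc_antiderivative cc_hump.
have fM (t : R) : 1 < `|t| -> hump t = 0.
  move=> t1; apply: hump_out; apply: contraL t1 => /andP[t0 t1].
  by rewrite -leNgt ger0_norm ltW.
have lt11 : -1 < 1 :> R by lra.
rewrite (Ir_FTC cc_hump.1 fM (lexx _) (lexx _) lt11 dF).
have [|c1 _ H1] := @MVT_all _ F hump (-1) 4^-1 dF; first lra.
have [|c2 c23 H2] := @MVT_all _ F hump 4^-1 2^-1 dF; first lra.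
have [|c3 _ H3] := @MVT_all _ F hump 2^-1 1 dF; first lra.
have p1 := hump_ge0 c1; have p3 := hump_ge0 c3.
have p2 : 0 < hump c2 by apply: hump_gt0; move/andP: c23 => [a b]; apply/andP; split; lra.
lra.
Qed.

(** [hump] lives on the unit interval, where cos(a t) is at least cos 1 > 0 as soon as |a| is at
    most 1. *)
Let Lc_hump_ge : exists2 c : R, 0 < c & forall a, `|a| <= 1 -> c <= Lc hump a 0.
Proof.
exists (cos 1 * Ir (hump : R -> R)); first by rewrite mulr_gt0 ?cos1_gt0 ?Ir_hump_gt0.
move=> a a1; rewrite -IrZ; last exact: cc_hump.
apply: le_Ir.
- by apply: ccZ; exact: cc_hump.
- exact: ccc cc_hump.
move=> t; have [/andP[t0 t1]|tout] := boolP (0 < t < 1); last first.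
  by rewrite hump_out// mulr0 mul0r.
rewrite mulrC mul0r expR0 mul1r ler_wpM2l ?hump_ge0//.
have -> : cos (a * t) = cos (`|a| * t).
  by case: (ler0P a) => // _; rewrite mulNr cosN.
have at0 : 0 <= `|a| * t by rewrite mulr_ge0// ltW.
have at1 : `|a| * t <= 1 by rewrite mulr_ile1// ltW.
have pi1 : 1 <= pi :> R by have := pi_ge2 R; lra.
rewrite leNgt; apply/negP; rewrite ltr_cos ?in_itv/= ?ler01 ?at0 ?(le_trans at1)//.
by rewrite ltNge at1.
Qed.

Lemma Re_LT_acor : exists2 c : R, 0 < c & forall D : nat, exists2 C : R, 0 <= C & forall n a,
  - (C / n.+1%:R) <= Re (LT (acor n) a 0) * (1 + `|a|) ^+ D /\
  (`|a| <= 1 -> c - C / n.+1%:R <= Re (LT (acor n) a 0)).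
Proof.
have [c c0 Hc] := Lc_hump_ge; have [K K0 HK] := RS_error.
exists (c ^+ 2); first by rewrite exprn_gt0.
move=> D; have [Cd Cd0 HCd] := LT_decay D.+1 0 (@smooth_hump R) cc_hump.
exists (2 * K * Cd); first by rewrite !mulr_ge0.
move=> n a; have [] := HK n a.
have := HCd a 0; rewrite normr0 lexx => /(_ isT).
rewrite LT_acor; have := ler_Re_cabs (LT hump a 0); have := ler_Im_cabs (LT hump a 0).
have := cabs_ge0 (LT hump a 0).
have := Hc a.
rewrite /LT /= normrN; move: (Lc hump a 0) (Ls hump a 0) (RS a cos n) (RS a sin n) (cabs _).
move=> X Y x y q Xc q0 Yq Xq qC hx hy.
have n0 : 0 < n.+1%:R :> R by rewrite ltr0n.
set e := K * (1 + `|a|) / n.+1%:R in hx hy.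
have e0 : 0 <= e by rewrite !mulr_ge0 ?invr_ge0 ?addr_ge0// ltW.
(* With exact values [x = X] and [y = Y] the right side would be X^2 + Y^2; each of the two
   approximations loses at most [e * q]. *)
have low : X ^+ 2 - 2 * e * q <= x * X - y * - Y.
  have h1 : (X - x) * X <= e * q.
    by rewrite (le_trans (ler_norm _))// normrM ler_pM.
  have h2 : (Y - y) * Y <= e * q.
    by rewrite (le_trans (ler_norm _))// normrM ler_pM.
  have := sqr_ge0 Y; nra.
have a1 : 1 <= 1 + `|a| by rewrite lerDl.
have eq_le : 2 * e * q * (1 + `|a|) ^+ D <= 2 * K * Cd / n.+1%:R.
  have -> : 2 * e * q * (1 + `|a|) ^+ D = 2 * K * (q * (1 + `|a|) ^+ D.+1) / n.+1%:R.
    by rewrite /e exprS; move: (n.+1%:R^-1) ((1 + `|a|) ^+ D) => u v; ring.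
  by rewrite ler_wpM2r ?invr_ge0 ?(ltW n0)// ler_wpM2l ?mulr_ge0.
have aD : 1 <= (1 + `|a|) ^+ D by rewrite exprn_ege1.
split.
  have aD0 := le_trans ler01 aD.
  apply: le_trans (ler_wpM2r aD0 low).
  have : 0 <= X ^+ 2 * (1 + `|a|) ^+ D by rewrite mulr_ge0 ?sqr_ge0.
  rewrite mulrBl => p; apply: (@le_trans _ _ (- (2 * e * q * (1 + `|a|) ^+ D))).
    by rewrite lerN2.
  by rewrite lerDr.
move=> /Xc cX; rewrite (le_trans _ low)//; apply: lerB.
  by rewrite lerXn2r ?nnegrE//; lra.
by rewrite (le_trans _ eq_le)// ler_peMr// !mulr_ge0.
Qed.

(** The constant [c] comes before [eps], so that [eps] may later be a fraction of [c]. Given [eps],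
    the index [n] of [acor] is chosen first, and the height [h0] of the strip afterwards, depending
    on [n]. *)
Lemma positive_test_function (D : nat) : exists2 c : R, 0 < c & forall eps, 0 < eps ->
  exists f : R -> R, [/\ smooth f, cc f & exists h0 : R, [/\ 0 < h0, h0 <= 1 & forall a b, `|b| <= h0 ->
    - eps <= Re (LT f a b) * (1 + `|a|) ^+ D /\ (`|a| <= 1 -> c <= Re (LT f a b))]].
Proof.
have [c c0 /(_ D) [C C0 HC]] := Re_LT_acor.
exists (c / 2); first by rewrite divr_gt0.
(* Two errors of size at most [m] occur, from the Riemann sum and from leaving the real axis.
   Together they stay below [eps] and below half of the original [c]. *)
move=> eps eps0; pose m := Num.min (eps / 2) (c / 4).
have m0 : 0 < m by rewrite lt_min !divr_gt0.
have m1 : m <= eps / 2 by rewrite ge_min lexx.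
have m2 : m <= c / 4 by rewrite ge_min lexx orbT.
pose n := Num.bound (C / m).
have Cn : C / n.+1%:R <= m.
  rewrite ler_pdivrMr ?ltr0n// mulrC -ler_pdivrMr// ltW//.
  rewrite (lt_le_trans (archi_boundP _)) ?divr_ge0 ?(ltW m0)//.
  by rewrite ler_nat leqW.
have [C' C'0 HC'] := LTB_decay D 1 (@smooth_acor n) (cc_acor n).
exists (acor n); split; [exact (@smooth_acor n)|exact: cc_acor|].
exists (Num.min 1 (m / (C' + 1))).
have C1 : 0 < C' + 1 by rewrite ltr_wpDl.
split; first by rewrite lt_min ltr01 divr_gt0.
  by rewrite ge_min lexx.
move=> a b; rewrite le_min => /andP[b1 bm].
have [H1 H2] := HC n a.
have bC : C' * `|b| <= m.
  move: bm; rewrite ler_pdivlMr// => bm; have := normr_ge0 b; nra.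
have := HC' a b b1; set z := LT (acor n) a b; set w := LT (acor n) a 0 in H1 H2 *.
move=> zw; have a1 : 1 <= 1 + `|a| by rewrite lerDl.
have aD : 1 <= (1 + `|a|) ^+ D by rewrite exprn_ege1.
have zwR : `|Re z - Re w| <= cabs (z - w) by rewrite -raddfB ler_Re_cabs.
have zwm : `|Re z - Re w| * (1 + `|a|) ^+ D <= m.
  by rewrite (le_trans _ bC)// (le_trans _ zw)// ler_wpM2r// (le_trans _ aD).
have lowz : Re w - `|Re z - Re w| <= Re z.
  by rewrite lerBlDr -lerBlDl distrC ler_norm.
clear HC HC' bm zw zwR; clearbody z w; clearbody n; move: (C / n.+1%:R) Cn H1 H2 => Cm Cn H1 H2.
split.
  have := ler_wpM2r (le_trans ler01 aD) lowz; rewrite mulrBl.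
  move: (Re w * _) (`|_| * _) (Re z * _) zwm H1 => p1 p2 p3; lra.
move=> /H2 cw; have : `|Re z - Re w| <= m.
  by rewrite (le_trans _ zwm)// ler_peMr.
lra.
Qed.

End Autocorrelation.

(** * Pure point measures *)

Section SummableFamilies.
Context {R : realType}.
Implicit Types (G : set R) (w g : R -> R).

Lemma esum_seq_split G (J : seq R) w : uniq J -> (forall x, x \in J -> G x) -> (forall x, 0 <= w x) ->
  \esum_(x in G) (w x)%:E = ((\sum_(x <- J) w x)%:E + \esum_(x in G `&` ~` [set` J]) (w x)%:E)%E.
Proof.
move=> uJ JG w0; rewrite (esumID [set` J]); last by move=> x _; rewrite lee_fin.
congr (_ + _)%E; have -> : G `&` [set` J] = [set` J].
  by apply/seteqP; split => x /=; [by case|by move=> xJ; split => //; exact: JG].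
have fJ : finite_set [set` J] by exact: finite_seq.
rewrite (esum_fset fJ) => [|x _]; last by rewrite lee_fin.
by rewrite -fsbig_seq// sumEFin.
Qed.

Lemma esum_small_tail G w (e : R) : (forall x, 0 <= w x) -> (\esum_(x in G) (w x)%:E < +oo)%E ->
  0 < e -> exists J : seq R, [/\ uniq J, (forall x, x \in J -> G x) &
    (\esum_(x in G `&` ~` [set` J]) (w x)%:E <= e%:E)%E].
Proof.
move=> w0 wfin e0.
have fin : \esum_(x in G) (w x)%:E \is a fin_num.
  by rewrite ge0_fin_numE// esum_ge0// => x _; rewrite lee_fin.
have [_ [F [finF FG] <-]] := ub_ereal_sup_adherent e0 fin.
rewrite -[X in (X - _ < _)%E]/(\esum_(x in G) (w x)%:E)%E fsbig_finite// sumEFin => H.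
pose J : seq R := finmap.enum_fset (fset_set F); rewrite -/J in H.
have uJ : uniq J by exact: finmap.fset_uniq.
have JG x : x \in J -> G x.
  by move=> xJ; apply: FG; rewrite -(fset_setK finF) /=.
exists J; split => //.
move: H; rewrite (esum_seq_split uJ JG w0) => H.
have tfin : \esum_(x in G `&` ~` [set` J]) (w x)%:E \is a fin_num.
  rewrite ge0_fin_numE; last by apply: esum_ge0 => x _; rewrite lee_fin.
  apply: le_lt_trans wfin; rewrite (esum_seq_split uJ JG w0) leeDr//.
  by rewrite lee_fin sumr_ge0.
move: H; rewrite -(fineK tfin) lteBlDr// -!EFinD lte_fin lee_fin; lra.
Qed.

Lemma rsum_abs_le G g (w : R -> R) (C : R) : (forall x, G x -> `|g x| <= w x) ->
  (\esum_(x in G) (w x)%:E <= C%:E)%E -> `|rsum G g| <= C.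
Proof.
move=> gw wC.
have H k : (forall x, G x -> k x <= w x) -> (forall x, G x -> 0 <= w x) ->
    0 <= fine (\esum_(x in G) (Num.max (k x) 0)%:E) <= C.
  move=> kw w0; have le : (\esum_(x in G) (Num.max (k x) 0)%:E <= C%:E)%E.
    apply: le_trans wC; apply: le_esum => x Gx.
    by rewrite lee_fin ge_max kw// w0.
  have ge : (0 <= \esum_(x in G) (Num.max (k x) 0)%:E)%E.
    by apply: esum_ge0 => x _; rewrite lee_fin le_max lexx orbT.
  have fin : \esum_(x in G) (Num.max (k x) 0)%:E \is a fin_num.
    by rewrite ge0_fin_numE// (le_lt_trans le)// ltry.
  by rewrite -!lee_fin fineK// ge le.
have w0 x : G x -> 0 <= w x by move=> /gw; apply: le_trans.
have /andP[a1 a2] := H g (fun x Gx => le_trans (ler_norm _) (gw x Gx)) w0.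
have /andP[b1 b2] : 0 <= fine (\esum_(x in G) (Num.max (- g x) 0)%:E) <= C.
  apply: (H (fun x => - g x)) => // x Gx; apply: le_trans (gw x Gx).
  by rewrite -normrN ler_norm.
by rewrite /rsum ler_norml; apply/andP; split; lra.
Qed.

Lemma rsum_approx G (J : seq R) g w (e : R) : uniq J -> (forall x, x \in J -> G x) ->
  (forall x, `|g x| <= w x) -> (\esum_(x in G) (w x)%:E < +oo)%E ->
  (\esum_(x in G `&` ~` [set` J]) (w x)%:E <= e%:E)%E ->
  `|rsum G g - \sum_(x <- J) g x| <= e.
Proof.
move=> uJ JG gw wfin we.
have w0 x : 0 <= w x by apply: le_trans (gw x).
have H k : (forall x, k x <= w x) ->
   fine (\esum_(x in G) (Num.max (k x) 0)%:E) = \sum_(x <- J) Num.max (k x) 0 +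
   fine (\esum_(x in G `&` ~` [set` J]) (Num.max (k x) 0)%:E).
  move=> kw; rewrite (esum_seq_split uJ JG); last by move=> x; rewrite le_max lexx orbT.
  rewrite fineD//.
  rewrite ge0_fin_numE; last by apply: esum_ge0 => x _; rewrite lee_fin le_max lexx orbT.
  apply: (@le_lt_trans _ _ e%:E); last exact: ltry.
  by apply: le_trans we; apply: le_esum => x _; rewrite lee_fin ge_max kw w0.
have Eg : \sum_(x <- J) g x = \sum_(x <- J) Num.max (g x) 0 - \sum_(x <- J) Num.max (- g x) 0.
  rewrite -sumrB; apply: eq_bigr => x _; rewrite /Num.max.
  by case: ltP => h1; case: ltP => h2; lra.
have := @rsum_abs_le (G `&` ~` [set` J]) g w e (fun x _ => gw x) we.
rewrite /rsum (H g) ?(H (fun x => - g x))//; last first.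
- by move=> x; rewrite (le_trans (ler_norm _)).
- by move=> x; rewrite (le_trans _ (gw x))// -normrN ler_norm.
set a := fine _; set b := fine _; set c := \sum_(x <- J) _; set d := \sum_(x <- J) _.
rewrite Eg -/c -/d; have -> : c + a - (d + b) - (c - d) = a - b by ring.
by [].
Qed.

Lemma rsum_setIr G (X : set R) g : (forall x, ~ X x -> g x = 0) -> rsum G g = rsum (G `&` X) g.
Proof.
move=> g0; rewrite /rsum !esum_mkcondr; congr (fine _ - fine _);
  apply: eq_esum => x _; case: ifPn => //; rewrite notin_setE => /g0 ->;
  by rewrite ?oppr0 maxxx.
Qed.

(** The Riesz product bound concerns finite sums. A finite part carrying all but e/3 of the mass
    changes the trigonometric sum by at most e/3, uniformly in [t], and 2 (A + e/3) + e/3 = 2 A +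
    e. *)
Lemma esum_le_of_csum G (a : R -> R[i]) (A : R) : Zlin_indep G ->
  (\esum_(x in G) (cabs (a x))%:E < +oo)%E ->
  (forall t, Re (csum G (fun x => a x * cis (t * x))) <= A) ->
  (\esum_(x in G) (cabs (a x))%:E <= (2 * A)%:E)%E.
Proof.
move=> indG afin leA; apply/lee_addgt0Pr => e e0.
have e3 : 0 < e / 3 by rewrite divr_gt0.
have [J [uJ JG Je]] := esum_small_tail (fun x => cabs_ge0 (a x)) afin e3.
rewrite (esum_seq_split uJ JG) => [|x]; last exact: cabs_ge0.
apply: (@le_trans _ _ ((2 * (A + e / 3))%:E + (e / 3)%:E)%E).
  apply: leeD => //; rewrite lee_fin.
  apply: (riesz_bound indG uJ JG) => t; rewrite raddf_sum /=.
  have := leA t; rewrite /csum /= => H.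
  have := @rsum_approx G J (fun x => Re (a x * cis (t * x))) (fun x => cabs (a x)) (e / 3) uJ JG.
  move=> /(_ _ afin Je); rewrite ler_distl => K.
  have /K/andP[K1 K2] x : `|Re (a x * cis (t * x))| <= cabs (a x).
    by rewrite (le_trans (ler_Re_cabs _))// cabsM cabs_cis mulr1.
  lra.
by rewrite -!EFinD lee_fin; lra.
Qed.

End SummableFamilies.

(** * Removal of polynomial growth by iteration *)

Section Contraction.
Context {R : realType}.

(** The constant [2 * A] is the fixed point of alpha -> A + alpha/2, and each step halves the
    coefficient of [w s]; for fixed [s] this coefficient tends to 0. *)
Lemma contraction_bound (V : R -> \bar R) (w : R -> R) (A C : R) : 0 <= A -> 0 <= C ->
  (forall s, 0 <= w s) ->
  (forall s, (0 <= V s)%E) ->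
  (forall s, (V s <= (C * w s)%:E)%E) ->
  (forall alpha beta, 0 <= alpha -> 0 <= beta -> (forall s, (V s <= (alpha + beta * w s)%:E)%E) ->
    forall s, (V s <= (A + (alpha + beta * w s) / 2)%:E)%E) ->
  forall s, (V s <= (2 * A)%:E)%E.
Proof.
move=> A0 C0 w0 V0 VC step.
have it n : forall s, (V s <= (2 * A + C / 2 ^+ n * w s)%:E)%E.
  elim: n => [|n IH] s.
    by apply: le_trans (VC s) _; rewrite lee_fin expr0 divr1 lerDr mulr_ge0.
  have A20 : 0 <= 2 * A by rewrite mulr_ge0.
  have Cn0 : 0 <= C / 2 ^+ n by rewrite divr_ge0// exprn_ge0.
  have := step (2 * A) (C / 2 ^+ n) A20 Cn0 IH s.
  move=> /le_trans; apply; rewrite lee_fin exprS invfM.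
  by move: (2 ^- n) => u; lra.
move=> s; have := V0 s; have := VC s; have := it^~ s.
case: (V s) => [v|//|//] itv _ _; rewrite lee_fin leNgt; apply/negP => Av.
pose B := C * w s / (v - 2 * A).
have vA : 0 < v - 2 * A by rewrite subr_gt0.
have B0 : 0 <= B by rewrite divr_ge0 ?mulr_ge0// ltW.
have := itv (Num.bound B); rewrite lee_fin leNgt => /negP; apply.
rewrite -ltrBrDl mulrAC ltr_pdivrMr ?exprn_gt0//.
rewrite [ltRHS]mulrC -ltr_pdivrMr// -/B (lt_le_trans (archi_boundP B0))//.
by rewrite -natrX ler_nat ltnW// ltn_expl.
Qed.

End Contraction.

Section TestFunctions.
Context {R : realType}.

Lemma test_fun_modulated (f : R -> R) (s : R) : smooth f -> cc f ->
  test_fun (fun t => (f t)%:C * cis (s * t)).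
Proof.
move=> sf [_ [M fM]]; split; last split.
- rewrite (_ : (fun _ => _) = (fun t => f t * cos (s * t + 0))).
    exact (smoothM sf (@smooth_affine R _ s 0 (@smooth_cos R))).
  by apply/funext => t; rewrite /cis; simpc; rewrite ?addr0.
- rewrite (_ : (fun _ => _) = (fun t => f t * sin (s * t + 0))).
    exact (smoothM sf (@smooth_affine R _ s 0 (@smooth_sin R))).
  by apply/funext => t; rewrite /cis; simpc; rewrite ?addr0.
- by exists M => t /fM ->; rewrite mul0r.
Qed.

End TestFunctions.

(** * Mass of a pure point measure: from short windows to long intervals *)

Section PurePoint.
Context {R : realType}.
Variables (Gamma : set R) (b : R -> R[i]).
Hypothesis local_finite : forall K : set R, compact K ->
  (\esum_(g in Gamma `&` K) (cabs (b g))%:E < +oo)%E.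

Lemma esumZ_le (G : set R) (w : R -> R) (K : R) : 0 <= K -> (forall x, 0 <= w x) ->
  (\esum_(x in G) (K * w x)%:E <= K%:E * \esum_(x in G) (w x)%:E)%E.
Proof.
move=> K0 w0; apply: ge_ereal_sup => _ [F [finF FG] <-].
rewrite fsbig_finite// sumEFin -mulr_sumr EFinM.
apply: lee_wpmul2l; first by rewrite lee_fin.
apply: esum_ge; exists F; first by split.
by rewrite fsbig_finite// sumEFin.
Qed.

Lemma esum_weighted_finite (f : R -> R) : cc f ->
  exists2 A : R, 0 <= A & (\esum_(x in Gamma) (cabs (b x) * `|f x|)%:E <= A%:E)%E.
Proof.
move=> ccf; have [K K0 fK] := bounded_cc ccf; have [M M0 fM] := cc_supp ccf.
pose I : set R := [set` `[- M, M]].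
have lf := local_finite (@segment_compact R (- M)%R M); rewrite -/I in lf.
set E := \esum_(g in _) _ in lf.
have lf0 : (0 <= E)%E by apply: esum_ge0 => x _; rewrite lee_fin cabs_ge0.
have ffin : E \is a fin_num by rewrite ge0_fin_numE.
exists (K * fine E); first by rewrite mulr_ge0 ?fine_ge0.
rewrite EFinM fineK// /E; apply: le_trans (@esumZ_le _ _ _ K0 (fun x => cabs_ge0 (b x))).
rewrite esum_mkcondr; apply: le_esum => x _; case: ifPn => [_|].
  by rewrite lee_fin mulrC ler_wpM2r ?cabs_ge0.
rewrite notin_setE /I /= in_itv /= -ler_norml => /negP; rewrite -ltNge => /fM ->.
by rewrite normr0 mulr0.
Qed.

Lemma pp_var_sub (S T : set R) : S `<=` T -> (pp_var Gamma b S <= pp_var Gamma b T)%E.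
Proof.
move=> ST; rewrite /pp_var !esum_mkcondr; apply: le_esum => x _.
case: ifPn => [|_]; first by rewrite !inE => /ST xT; rewrite mem_set.
by case: ifP => // _; rewrite lee_fin cabs_ge0.
Qed.

Lemma pp_varU (S T : set R) :
  (pp_var Gamma b (S `|` T) <= pp_var Gamma b S + pp_var Gamma b T)%E.
Proof.
have c0 x : (0 <= (cabs (b x))%:E)%E by rewrite lee_fin cabs_ge0.
rewrite /pp_var !esum_mkcondr -esumD; last 2 first.
- by move=> x _; case: ifP.
- by move=> x _; case: ifP.
apply: le_esum => x _; rewrite in_setU.
by case: (x \in S); case: (x \in T); rewrite /= ?adde0 ?add0e// leeDl.
Qed.

(** Windows of half-width [d] centred at the points x + j d with j < n: consecutive ones overlap, so
    the division points are covered too. *)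
Lemma pp_var_cover (d k C m x : R) (n : nat) : 0 < d -> 0 <= C -> 0 <= k ->
  (forall u, (pp_var Gamma b [set y | (u - d < y < u + d)%R] <= (C * expR (k * `|u|))%:E)%E) ->
  (forall u, x <= u <= x + n%:R * d -> `|u| <= m) ->
  (pp_var Gamma b [set y | (x < y < x + n%:R * d)%R] <= (n%:R * (C * expR (k * m)))%:E)%E.
Proof.
move=> d0 C0 k0 loc; elim: n => [|n IH] um.
  rewrite /pp_var (_ : _ `&` _ = set0) ?esum_set0 ?mul0r//.
  apply/seteqP; split => [y [_ /= /andP[h1 h2]]|//].
  by have := lt_trans h1 h2; rewrite addr0 ltxx.
have nd : n%:R * d <= n.+1%:R * d by rewrite ler_wpM2r ?ler_nat// ltW.
pose v := x + n%:R * d.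
apply: (@le_trans _ _ (pp_var Gamma b ([set y | (x < y < x + n%:R * d)%R] `|`
    [set y | (v - d < y < v + d)%R])%E)).
  apply: pp_var_sub => y /= /andP[h1 h2]; have [h3|h3] := ltP y (x + n%:R * d).
    by left; apply/andP; split.
  right; apply/andP; split; first by rewrite /v; lra.
  by move: h2; rewrite /v -natr1 mulrDl mul1r addrA.
rewrite (le_trans (pp_varU _ _))// -[n.+1%:R]natr1 mulrDl mul1r EFinD; apply: leeD.
  by apply: IH => u /andP[h1 h2]; apply: um; rewrite h1/= (le_trans h2)// lerD2l.
rewrite (le_trans (loc v))// lee_fin ler_wpM2l// ler_expR ler_wpM2l//.
by apply: um; rewrite /v lerD2l nd andbT lerDl mulr_ge0// ltW.
Qed.

Lemma pp_var_exponential_growth (d H C : R) : 0 < d -> 0 <= C -> 0 < H ->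
  (forall u, (pp_var Gamma b [set y | (u - d < y < u + d)%R] <= (C * expR (2 * pi * H * `|u|))%:E)%E) ->
  (exists C T : R, forall t : R, T < `|t| ->
     (pp_var Gamma b [set x | (t - 1 < x < t + 1)%R]
        <= (C * expR (2 * pi * H * `|t|))%R%:E)%E)
  /\
  (forall e : R, 0 < e -> exists r0 : R, forall r : R, r0 < r ->
     (pp_var Gamma b [set x | (- r < x < r)%R] <= (expR ((2 * pi * H + e) * r))%R%:E)%E).
Proof.
move=> d0 C0 H0; set k := 2 * pi * H => loc.
have k0 : 0 <= k by rewrite !mulr_ge0 ?pi_ge0// ltW.
have cover (z : R) : 0 <= z -> exists n : nat, n%:R <= z / d + 1 /\ z <= n%:R * d.
  move=> z0; exists (Num.truncn (z / d)).+1.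
  have /andP[h1 h2] := truncn_itv (divr_ge0 z0 (ltW d0)).
  by rewrite -ler_pdivrMr// (ltW h2) -natr1 lerD2r h1.
split.
  have [n [n1 n2]] := cover 2 (ler0n _ _).
  exists (n%:R * (C * expR (k * (1 + n%:R * d)))), 0 => t _.
  apply: (@le_trans _ _ (pp_var Gamma b [set y | (t - 1 < y < (t - 1) + n%:R * d)%R])).
    by apply: pp_var_sub => y /= /andP[-> h2] /=; lra.
  apply: le_trans (pp_var_cover (m := `|t| + (1 + n%:R * d)) d0 C0 k0 loc _) _.
    move=> u /andP[u1 u2]; have := ler_norm t; have := ler_norm (- t); rewrite normrN => t1 t2.
    by rewrite ler_norml; apply/andP; split; lra.
  by rewrite lee_fin mulrDr expRD; move: (expR _) (expR _) => x y; rewrite le_eqVlt; apply/orP; left; apply/eqP; ring.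
move=> e e0.
pose K := (2 / d + 1) * (C * expR (k * d)).
have K0 : 0 <= K.
  have d2 : 0 <= 2 / d by rewrite divr_ge0 // ltW.
  by rewrite /K mulr_ge0 ?(addr_ge0 d2) ?(mulr_ge0 C0) ?expR_ge0.
(* About 2r/d windows are needed, at most (2/d + 1) r once r exceeds 1. Beyond 4K/e^2 the product K
   r is below (e r)^2 / 2, hence below exp(e r), so the number of windows disappears into the [e] of
   the exponent. *)
pose r0 := Num.max 1 (4 * K / e ^+ 2).
exists r0 => r; rewrite gt_max => /andP[r1 rK].
have r00 : 0 < r by lra.
have [n [n1 n2]] := cover (2 * r) (mulr_ge0 (ler0n _ _) (ltW r00)).
apply: (@le_trans _ _ (pp_var Gamma b [set y | (- r < y < - r + n%:R * d)%R])).
  by apply: pp_var_sub => y /= /andP[-> h2] /=; lra.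
have nd : n%:R * d <= 2 * r + d.
  by move: n1; rewrite -(ler_pM2r d0) mulrDl mul1r divfK ?gt_eqF.
apply: le_trans (pp_var_cover (m := r + d) d0 C0 k0 loc _) _.
  by move=> u /andP[u1 u2]; rewrite ler_norml; apply/andP; split; lra.
rewrite lee_fin mulrDr expRD mulrDl expRD.
have : n%:R * (C * expR (k * d)) <= expR (e * r).
  have nr : n%:R <= (2 / d + 1) * r.
    rewrite (le_trans n1)// (_ : (2 / d + 1) * r = 2 * r / d + r); last by ring.
    by rewrite lerD2l ltW.
  apply: (@le_trans _ _ (K * r)).
    by rewrite /K [leRHS]mulrAC ler_wpM2r// mulr_ge0 ?expR_ge0.
  have er0 : 0 <= e * r by rewrite mulr_ge0 ?ltW.
  apply: le_trans (expR_ge1Dxn 1 er0).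
  move: rK; rewrite ltr_pdivrMr ?exprn_gt0// => rK.
  rewrite (_ : (2`!)%:R = 2 :> R)//; nra.
move: (expR (k * r)) (expR_ge0 (k * r)) => E E0 le.
rewrite (_ : _ * _ = E * (n%:R * (C * expR (k * d)))); last by ring.
by rewrite ler_wpM2l.
Qed.

End PurePoint.

(** * Growth of the transform *)

Section FourierBounds.
Context {R : realType}.
Variables (H : R) (nu : {measure set (R * R) -> \bar R}) (h : R * R -> R[i]).
Variables (Gamma : set R) (b : R -> R[i]).
Hypothesis H0 : 0 < H.
Hypothesis nuH : nu (~` strip H) = 0%E.
Hypothesis local_finite : forall K : set R, compact K ->
  (\esum_(g in Gamma `&` K) (cabs (b g))%:E < +oo)%E.
Hypothesis cFT_pure_point : forall phi : R -> R[i], test_fun phi ->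
  cintegral nu setT (fun p => cFT phi (cpt p) * h p) = csum Gamma (fun g => b g * phi g).

(** The exponent is rounded up to a natural number because the shell estimates use integer powers;
    the band lies in |Re z| <= |s| + L, and |s| + L is at most (1 + L)(1 + |s|/L). *)
Lemma band_polynomial_growth (C0 rho L : R) : 0 < C0 -> 0 < rho -> 0 < L ->
  (forall r : R, 0 < r ->
    (nu [set p | strip H p /\ (`|p.1| <= r)%R] <= (C0 * Num.max 1 (r `^ rho))%R%:E)%E) ->
  exists2 C : R, 0 <= C &
    forall s, (nu (band H L s) <= (C * (1 + `|s| / L) ^+ Num.bound rho)%:E)%E.
Proof.
move=> C00 rho0 L0 growth.
set N := Num.bound rho; have rhoN : rho <= N%:R by rewrite ltW// archi_boundP// ltW.
exists (C0 * (1 + L) ^+ N).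
  by rewrite mulr_ge0 ?exprn_ge0 ?addr_ge0 ?ltW.
move=> s; have r0 : 0 < `|s| + L by rewrite ltr_wpDl.
apply: (@le_trans _ _ (nu [set p | strip H p /\ (`|p.1| <= `|s| + L)%R])).
  apply: le_measure; rewrite ?inE.
  - exact: measurable_band.
  - have := measurable_band H (`|s| + L) 0; congr measurable.
    by apply/seteqP; split => p; rewrite /band /= subr0.
  - move=> p [pH ps]; split => //.
    by rewrite -(subrK s p.1) (le_trans (ler_normD _ _))// addrC lerD2l.
apply: le_trans (growth _ r0) _; rewrite lee_fin -mulrA ler_wpM2l ?(ltW C00)// -exprMn.
set x := (1 + L) * (1 + `|s| / L).
have sL0 : 0 <= `|s| / L by rewrite divr_ge0// ltW.
have x1 : 1 <= x by rewrite /x; nra.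
have rx : `|s| + L <= x.
  have -> : `|s| + L = L * (1 + `|s| / L) by rewrite mulrDr mulr1 mulrCA divff ?gt_eqF// mulr1 addrC.
  by rewrite /x mulrDl mul1r lerDr; lra.
rewrite ge_max exprn_ege1//=.
apply: (@le_trans _ _ (x `^ rho)).
  by apply: ge0_ler_powR; rewrite ?nnegrE ?(ltW rho0) ?(ltW r0)// (le_trans _ x1).
by rewrite -powR_mulrn ?(le_trans _ x1)//; exact: ler_powR.
Qed.

Lemma positive_translation_bounded (C0 rho : R) : (forall p, h p = 1) -> 0 < C0 -> 0 < rho ->
  (forall r : R, 0 < r ->
    (nu [set p | strip H p /\ (`|p.1| <= r)%R] <= (C0 * Num.max 1 (r `^ rho))%R%:E)%E) ->
  exists2 L, 0 < L & exists2 A : R, 0 <= A & forall s, (nu (band H L s) <= A%:E)%E.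
Proof.
move=> h1 C00 rho0 growth; set N := Num.bound rho.
have [c c0 Hc] := @positive_test_function R N.+2.
(* [band_integral] multiplies this by 4, and the final division by [c] leaves the contraction factor
   1/2. *)
have e0 : 0 < c / 8 by rewrite divr_gt0.
have [f [sf ccf [h0 [h00 h01 Hf]]]] := Hc _ e0.
pose L := H / h0; have L0 : 0 < L by rewrite divr_gt0.
have LE : h0 * L = H by rewrite /L mulrCA divff ?mulr1// gt_eqF.
clearbody L.
have [C C_ge0 VC] := band_polynomial_growth C00 rho0 L0 growth.
have [Cd Cd0 HCd] := LT_decay N.+2 h0 sf ccf.
(* The factor 2 pi of the Fourier kernel and the length [L] are removed by one dilation: the
   transform of [fk], modulated by 2 pi s, is [LT f] at ((x - s)/L, y/L), and |y|/L is at most [h0]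
   on S_H. *)
pose k := 2 * pi * L; have k0 : 0 < k by rewrite (mulr_gt0 _ L0)// mulr_gt0 ?pi_gt0.
have cck : cc (fun t => f (k * t)).
  by have := cc_affine 0 k0 ccf; under eq_fun do rewrite addr0.
pose fk t := k * f (k * t).
have ccfk : cc fk by exact: ccZ.
have sfk : smooth fk.
  apply: smoothM; first exact (@smooth_cst R k).
  by have := @smooth_affine R f k 0 sf; under eq_fun do rewrite addr0.
(* Modulation has modulus 1, so this bound of the pure point side holds for all [s] at once. *)
have [A A0 HA] := esum_weighted_finite local_finite ccfk.
pose F s (p : R * R) := LT f ((p.1 - s) / L) (p.2 / L).
have FE s p : cFT (fun t => (fk t)%:C * cis (2 * pi * s * t)) (cpt p) = F s p.
  rewrite cFT_LT// /fk LTZ// LT_scale// mulrA -rmorphM /= divff ?gt_eqF// mul1r /F.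
  have p0 : pi != 0 :> R by rewrite gt_eqF ?pi_gt0.
  by congr LT; rewrite /k; move: (@pi R) p0 => q q0; field; rewrite q0 gt_eqF.
have Rint s : Rintegral nu setT (fun p => Re (F s p)) <= A.
  have := cFT_pure_point (test_fun_modulated (2 * pi * s) sfk ccfk).
  rewrite (_ : (fun p => _) = F s); last by apply/funext => p; rewrite FE h1 mulr1.
  rewrite /cintegral /csum => -[-> _].
  rewrite (le_trans (ler_norm _))//; apply: rsum_abs_le HA => x _.
  rewrite (le_trans (ler_Re_cabs _))// !cabsM cabs_cis mulr1 cabs_real//.
have stripb p : strip H p -> `|p.2 / L| <= h0.
  rewrite /strip /= => pH; rewrite normrM [`|L^-1|]gtr0_norm ?invr_gt0//.
  by rewrite ler_pdivrMr// LE.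
have normL s (p : R * R) : `|(p.1 - s) / L| = `|p.1 - s| / L.
  by rewrite normrM [`|L^-1|]gtr0_norm ?invr_gt0.
have step alpha beta : 0 <= alpha -> 0 <= beta ->
    (forall s, (nu (band H L s) <= (alpha + beta * (1 + `|s| / L) ^+ N)%:E)%E) ->
    forall s, (nu (band H L s) <= (A / c + (alpha + beta * (1 + `|s| / L) ^+ N) / 2)%:E)%E.
  move=> alpha0 beta0 Vle s; set W := alpha + _.
  have Uge0 p : 0 <= (1 + `|p.1 - s| / L) ^+ N.+2.
    by rewrite exprn_ge0// addr_ge0// divr_ge0// ltW.
  have neg : (\int[nu]_p (Num.max (- Re (F s p)) 0)%:E <= (4 * (c / 8) * W)%:E)%E.
    apply: (band_integral nuH L0 alpha0 beta0 Vle (ltW e0)).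
      by move=> p; rewrite lee_fin le_max lexx orbT.
    move=> p pH; rewrite -EFinM lee_fin.
    have [+ _] := Hf ((p.1 - s) / L) (p.2 / L) (stripb p pH); rewrite normL -/(F s p).
    rewrite maxr_pMl// mul0r ge_max (ltW e0) andbT mulNr; lra.
  (* This bound grows with [W] and serves for finiteness; the useful bound of the positive part is
     the real integral, at most [A], plus the small negative part. *)
  have pos : (\int[nu]_p (Num.max (Re (F s p)) 0)%:E <= (4 * Cd * W)%:E)%E.
    apply: (band_integral nuH L0 alpha0 beta0 Vle Cd0).
      by move=> p; rewrite lee_fin le_max lexx orbT.
    move=> p pH; rewrite -EFinM lee_fin.
    have := HCd ((p.1 - s) / L) (p.2 / L) (stripb p pH); rewrite normL -/(F s p).
    rewrite maxr_pMl// mul0r ge_max Cd0 andbT; apply: le_trans.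
    by rewrite ler_wpM2r// (le_trans (ler_norm _))// ler_Re_cabs.
  have low : (c%:E * nu (band H L s) <= \int[nu]_p (Num.max (Re (F s p)) 0)%:E)%E.
    rewrite -integral_cst; last exact: measurable_band.
    rewrite integral_mkcond; apply: ge0_le_integralT => p; rewrite patchE; case: ifPn => //.
    - by move=> _; rewrite lee_fin ltW.
    - rewrite inE => -[pH ps]; rewrite lee_fin le_max.
      have [_ ->//] := Hf ((p.1 - s) / L) (p.2 / L) (stripb p pH).
      by rewrite normL ler_pdivrMr// mul1r.
    - by move=> _; rewrite lee_fin le_max lexx orbT.
  have := le_trans low (Rintegral_pos_le pos neg).
  have V0 : (0 <= nu (band H L s))%E by [].
  have Vfin : nu (band H L s) \is a fin_num by rewrite ge0_fin_numE// (le_lt_trans (Vle s))// ltry.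
  rewrite -(fineK Vfin) -EFinM !lee_fin => le.
  have := Rint s; move: le; move: (Rintegral _ _ _) (fine _) => I v le IA.
  rewrite -ler_pdivlMl// in le; apply: (le_trans le).
  rewrite mulrDr [A / c]mulrC lerD ?ler_wpM2l ?invr_ge0 ?(ltW c0)//.
  rewrite le_eqVlt; apply/orP; left; apply/eqP; field; by rewrite gt_eqF.
have w0 (s : R) : 0 <= (1 + `|s| / L) ^+ N by rewrite exprn_ge0// addr_ge0// divr_ge0// ltW.
have Ac0 : 0 <= A / c by rewrite divr_ge0// ltW.
exists L => //; exists (2 * (A / c)); first by rewrite mulr_ge0.
apply: (@contraction_bound _ (fun s => nu (band H L s)) (fun s => (1 + `|s| / L) ^+ N)
  (A / c) C Ac0 C_ge0 w0 _ VC step) => //.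
Qed.

(** The bump is supported in the window of half-width [eta], where the frequencies are independent,
    and is bounded below on the half window; hence the loss from [eta] to [eta / 2]. *)
Lemma local_exponential_bound (eta L A : R) : (forall p, cabs (h p) = 1) -> 0 < L -> 0 <= A ->
  (forall s, (nu (band H L s) <= A%:E)%E) -> 0 < eta ->
  (forall t : R, Zlin_indep (Gamma `&` [set x | t - eta < x < t + eta])) ->
  exists2 C : R, 0 <= C & forall u, (pp_var Gamma b [set y | (u - eta / 2 < y < u + eta / 2)%R]
    <= (C * expR (2 * pi * H * `|u|))%:E)%E.
Proof.
move=> h1 L0 A0 VA eta0 indep.
(* This dilation, with the shift by 1/2, carries the window |t| < eta onto the interval (0, 1) where
   [hump] is positive. *)
pose k := (2 * eta)^-1; have k0 : 0 < k by rewrite invr_gt0 mulr_gt0.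
pose f (t : R) : R := hump (k * t + 2^-1).
have sf : smooth f by exact (@smooth_affine R _ k 2^-1 (@smooth_hump R)).
have ccf : cc f by apply: (cc_affine _ k0); exact: cc_hump.
have f0 t : 0 <= f t by exact: hump_ge0.
have f_out t : eta <= `|t| -> f t = 0.
  move=> te; apply: hump_out; apply: contraL te => /andP[t0 t1]; rewrite -ltNge ltr_norml.
  have : (k * t) * (2 * eta) = t by rewrite /k mulrAC mulVf ?mul1r// gt_eqF// mulr_gt0.
  by move=> kt; apply/andP; split; nra.
(* On the half window the argument x of [hump] lies between 1/4 and 3/4, where x(1 - x) is at least
   3/16. *)
pose m : R := expR (- (16 / 3)).
have m0 : 0 < m by exact: expR_gt0.
have f_in t : `|t| < eta / 2 -> m <= f t.
  rewrite ltr_norml => /andP[t0 t1]; rewrite /f.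
  have kt : (k * t) * (2 * eta) = t by rewrite /k mulrAC mulVf ?mul1r// gt_eqF// mulr_gt0.
  move: (k * t) kt => q kt.
  have q1 : - 4^-1 < q by nra.
  have q2 : q < 4^-1 by nra.
  rewrite /hump ifT; last by apply/andP; split; lra.
  rewrite /m ler_expR lerN2 -[leRHS]invrK lef_pV2 ?posrE ?invr_gt0 ?divr_gt0//; last by nra.
  by rewrite invfM invrK; nra.
pose B := 2 * pi * H; have B0 : 0 <= B by rewrite !mulr_ge0 ?pi_ge0// ltW.
have [Cd Cd0 HCd] := LT_decay 2 B sf ccf.
(* Compares the two scales: decay is known in |2 pi x - t|, the bands are measured in |x - s|/L with
   s = t/(2 pi). *)
pose kap := 1 + (2 * pi * L)^-1.
have kap0 : 0 <= kap by rewrite addr_ge0// invr_ge0 !mulr_ge0 ?pi_ge0// ltW.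
pose D := 4 * (kap ^+ 2 * Cd) * A.
have D0 : 0 <= D by rewrite !mulr_ge0 ?exprn_ge0.
exists (m^-1 * (2 * D)); first by rewrite !mulr_ge0// invr_ge0 ltW.
move=> u; pose fu t := f (t + - u); pose E := expR (B * `|u|).
have E0 : 0 <= E by exact: expR_ge0.
have ccfu : cc fu.
  by have := cc_affine (- u) ltr01 ccf; under eq_fun do rewrite mul1r.
have sfu : smooth fu.
  by have := @smooth_affine R f 1 (- u) sf; under eq_fun do rewrite mul1r.
pose X := [set x | u - eta < x < u + eta].
have fuX x : ~ X x -> fu x = 0.
  move=> nX; apply: f_out; rewrite leNgt; apply/negP; rewrite ltr_norml => /andP[x1 x2].
  by apply: nX; apply/andP; split; lra.
pose a x := b x * (fu x)%:C.
have cabsa x : cabs (a x) = cabs (b x) * `|fu x| by rewrite cabsM cabs_real.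
have [S S0 HS] := esum_weighted_finite local_finite ccfu.
have aX0 : (\esum_(x in Gamma `&` X) (cabs (a x))%:E <= \esum_(x in Gamma) (cabs (b x) * `|fu x|)%:E)%E.
  rewrite esum_mkcondr; apply: le_esum => x _; rewrite cabsa; case: ifP => // _.
  by rewrite lee_fin mulr_ge0 ?cabs_ge0.
have afin : (\esum_(x in Gamma `&` X) (cabs (a x))%:E < +oo)%E.
  by rewrite (le_lt_trans aX0)// (le_lt_trans HS)// ltry.
have csumle t : Re (csum (Gamma `&` X) (fun x => a x * cis (t * x))) <= D * E.
  pose phi x := (fu x)%:C * cis (t * x).
  have := cFT_pure_point (test_fun_modulated t sfu ccfu); rewrite -/phi => phiE.
  have -> : Re (csum (Gamma `&` X) (fun x => a x * cis (t * x))) = Re (csum Gamma (fun x => b x * phi x)).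
    rewrite /csum /= [RHS](@rsum_setIr _ Gamma X).
      by congr rsum; apply/funext => x; rewrite /a /phi mulrA.
    by move=> x /fuX fx; rewrite /phi fx mul0r mulr0.
  rewrite -phiE /cintegral /= (le_trans (ler_norm _))//.
  apply: (@Rintegral_abs_le _ _ _ nu _ (fun p => (cabs (cFT phi (cpt p)))%:E)).
    by move=> p; rewrite lee_fin (le_trans (ler_Re_cabs _))// cabsM h1 mulr1.
  pose s := t / (2 * pi).
  (* A translation bounded measure is the case [N = 0], [beta = 0] of the shell estimates, for which
     decay of order 2 is enough. *)
  have Vle s' : (nu (band H L s') <= (A + 0 * (1 + `|s'| / L) ^+ 0)%:E)%E by rewrite mul0r addr0.
  have e0 : 0 <= kap ^+ 2 * Cd * E by rewrite !mulr_ge0 ?exprn_ge0.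
  rewrite (_ : D * E = 4 * (kap ^+ 2 * Cd * E) * (A + 0 * (1 + `|s| / L) ^+ 0)); last first.
    by rewrite /D mul0r addr0; ring.
  apply: (band_integral nuH L0 A0 (lexx 0) Vle e0).
    by move=> p; rewrite lee_fin cabs_ge0.
  move=> p pH; rewrite -EFinM lee_fin cFT_LT// /fu LT_shift//.
  rewrite !cabsM cabs_cis mulr1 cabs_real [`|expR _|]ger0_norm ?expR_ge0//.
  have pB : `|2 * pi * p.2| <= B.
    by rewrite normrM ger0_norm ?mulr_ge0 ?pi_ge0// ler_wpM2l// mulr_ge0 ?pi_ge0.
  have := HCd (2 * pi * p.1 - t) (2 * pi * p.2) pB.
  move: (cabs_ge0 (LT f (2 * pi * p.1 - t) (2 * pi * p.2))).
  move: (cabs (LT f _ _)) => q q0 qC.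
  (* The cost of the translation by [u] at height |y| <= H. *)
  have eE : expR (- (2 * pi * p.2 * - u)) <= E.
    rewrite ler_expR mulrN opprK (le_trans (ler_norm _))// normrM.
    by rewrite ler_wpM2r.
  have pL : 1 + `|p.1 - s| / L <= kap * (1 + `|2 * pi * p.1 - t|).
    have pi2 : 0 < 2 * pi :> R by rewrite mulr_gt0 ?pi_gt0.
    have -> : `|2 * pi * p.1 - t| = 2 * pi * `|p.1 - s|.
      by rewrite -{2}(gtr0_norm pi2) -normrM /s mulrBr mulrCA divff ?mulr1// gt_eqF.
    have scale (q' w : R) : 0 < w -> q' / L = (w * L)^-1 * (w * q').
      by move=> w0; field; rewrite !gt_eqF.
    have := scale `|p.1 - s| (2 * pi) pi2.
    have z1 : 0 <= 2 * pi * `|p.1 - s| by rewrite mulr_ge0// (ltW pi2).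
    have z2 : 0 <= (2 * pi * L)^-1 by rewrite invr_ge0 mulr_ge0// ltW.
    move=> ->; rewrite /kap; move: (2 * pi * `|_|) (_^-1) z1 z2 => z c; nra.
  have pL0 : 0 <= 1 + `|p.1 - s| / L by rewrite addr_ge0// divr_ge0// ltW.
  have sq : (1 + `|p.1 - s| / L) ^+ 2 <= kap ^+ 2 * (1 + `|2 * pi * p.1 - t|) ^+ 2.
    rewrite -exprMn; apply: lerXn2r => //; rewrite nnegrE// mulr_ge0// addr_ge0//.
  apply: (@le_trans _ _ (E * q * (kap ^+ 2 * (1 + `|2 * pi * p.1 - t|) ^+ 2))).
    by apply: ler_pM => //; [rewrite mulr_ge0 ?expR_ge0|rewrite exprn_ge0|rewrite ler_wpM2r].
  rewrite [leLHS](_ : _ = kap ^+ 2 * E * (q * (1 + `|2 * pi * p.1 - t|) ^+ 2)); last by ring.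
  rewrite [leRHS](_ : _ = kap ^+ 2 * E * Cd); last by ring.
  by rewrite ler_wpM2l// mulr_ge0 ?exprn_ge0.
have sumle := esum_le_of_csum (indep u) afin csumle.
apply: (@le_trans _ _ (\esum_(x in Gamma `&` X) (m^-1 * cabs (a x))%:E)%E).
  rewrite /pp_var !esum_mkcondr; apply: le_esum => x _.
  have ma0 : 0 <= m^-1 * cabs (a x) by rewrite mulr_ge0 ?cabs_ge0// invr_ge0 ltW.
  case: ifPn => [|_]; last by case: ifP.
  rewrite inE /= => /andP[x1 x2]; rewrite mem_set; last by apply/andP; split; lra.
  rewrite lee_fin ler_pdivlMl// mulrC cabsa ler_wpM2l ?cabs_ge0//.
  rewrite (le_trans _ (ler_norm _))//; apply: f_in; rewrite ltr_norml; apply/andP; split; lra.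
apply: le_trans (@esumZ_le _ _ _ _ _ _) _.
- by rewrite invr_ge0 ltW.
- by move=> x; exact: cabs_ge0.
rewrite (_ : _ * expR _ = m^-1 * (2 * (D * E))); last by rewrite /E /B; ring.
rewrite [X in (_ <= X)%E]EFinM.
by apply: lee_wpmul2l; first by rewrite lee_fin invr_ge0 ltW.
Qed.

End FourierBounds.

(* The measure mu on S_H is given as mu = h d nu with nu = |mu| a positive
   measure on R*R (= C) carried by the strip and |h| = 1 (polar decomposition). *)
Theorem theorem3 (R : realType) (H : R) (nu : {measure set (R * R) -> \bar R})
  (h : R * R -> R[i]) (Gamma : set R) (b : R -> R[i]) (eta : R) :
  0 < H ->
  measurable_fun setT (fun p => Re (h p)) ->
  measurable_fun setT (fun p => Im (h p)) ->
  (forall p, cabs (h p) = 1) ->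
  nu (~` strip H) = 0%E ->
  ( (* (a) positive measure with polynomial growth *)
    ((forall p, h p = 1) /\
     exists C0 rho : R, 0 < C0 /\ 0 < rho /\
       forall r : R, 0 < r ->
         (nu [set p | strip H p /\ (`|p.1| <= r)%R] <= (C0 * Num.max 1 (r `^ rho))%R%:E)%E)
    \/
    (* (b) translation bounded complex measure *)
    (exists C : R, forall s : R,
       (nu [set p | strip H p /\ (s <= p.1 <= s + 1)%R] <= C%:E)%E) ) ->
  (* the c-Fourier transform of mu is the pure point measure sum b_g delta_g *)
  countable Gamma ->
  (forall K : set R, compact K ->
     (\esum_(g in Gamma `&` K) (cabs (b g))%:E < +oo)%E) ->
  (forall phi : R -> R[i], test_fun phi ->
     cintegral nu setT (fun p => cFT phi (cpt p) * h p)
     = csum Gamma (fun g => b g * phi g)) ->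
  0 < eta ->
  (forall t : R, Zlin_indep (Gamma `&` [set x | t - eta < x < t + eta])) ->
  (exists C T : R, forall t : R, T < `|t| ->
     (pp_var Gamma b [set x | (t - 1 < x < t + 1)%R]
        <= (C * expR (2 * pi * H * `|t|))%R%:E)%E)
  /\
  (forall e : R, 0 < e -> exists r0 : R, forall r : R, r0 < r ->
     (pp_var Gamma b [set x | (- r < x < r)%R] <= (expR ((2 * pi * H + e) * r))%R%:E)%E).
Proof.
move=> H0 _ _ h1 nuH growth _ locfin FT eta0 indep.
have [L L0 [A A0 VA]] : exists2 L, 0 < L & exists2 A : R, 0 <= A &
    forall s, (nu (band H L s) <= A%:E)%E.
  case: growth => [[hp [C0 [rho [C00 [rho0 nuC]]]]]|[C nuC]].
    exact: (positive_translation_bounded H0 nuH locfin FT hp C00 rho0 nuC).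
  (* A piece of length 1 is the band of half-width 1/2 about its midpoint. *)
  have mstrip s : measurable [set p : R * R | strip H p /\ (s <= p.1 <= s + 1)%R].
    have := measurable_band H 2^-1 (s + 2^-1); congr measurable.
    apply/seteqP; split => p [pH]; rewrite /= ?ler_norml => /andP[p1 p2];
      by split => //; rewrite ?ler_norml; apply/andP; split; lra.
  have C0 : 0 <= C.
    by rewrite -lee_fin (le_trans _ (nuC 0)).
  (* A band of half-width 1 is covered by two adjacent pieces of length 1. *)
  exists 1 => //; exists (C + C); first by rewrite addr_ge0.
  move=> s; rewrite EFinD.
  apply: (@le_trans _ _ (nu ([set p | strip H p /\ (s - 1 <= p.1 <= s - 1 + 1)%R] `|`
     [set p | strip H p /\ (s <= p.1 <= s + 1)%R]))).
    apply: le_measure; rewrite ?inE; [exact: measurable_band|by apply: measurableU; exact: mstrip|].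
    move=> p [pH]; rewrite ler_norml => /andP[p1 p2]; have [ps|ps] := leP p.1 s.
      by left; split => //; apply/andP; split; lra.
    by right; split => //; apply/andP; split; lra.
  by apply: le_trans (measureU2 _ (mstrip _) (mstrip _)) _; apply: leeD; exact: nuC.
have [C C0 loc] := local_exponential_bound H0 nuH locfin FT h1 L0 A0 VA eta0 indep.
by apply: (pp_var_exponential_growth (d := eta / 2) _ C0 H0 loc); rewrite divr_gt0.
Qed.
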